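(* There are choices of the constants $a,c_1,c_2$ in the construction below and an absolute constant $C$ such that the following holds for all integers $d\ge 2$, $m\ge1$. With probability at least $1-O(d^{-3})$ over the random choice of $\Phi$, the matrix $\Phi$ has the following property: for every $f\in\mathbb{R}^d$, given the sketch $V=\Phi f$ (which has $O(m\log^2 d)$ entries) and the matrix $\Phi$, the Chaining Pursuit algorithm produces a signal $\widehat f$ with at most $m$ nonzero entries satisfying $$\|f-\widehat f\|_1\le C(1+\log m)\,\|f-f_m\|_1 .$$ In particular, if $f_m=f$ then $\widehat f=f$. The running time of the algorithm is $O(m\log^2(m)\log^2(d))$ (assuming random access to the columns of the isolation matrix).
   Context: Signals are vectors $f\in\mathbb{R}^d$ with coordinates indexed by $\{0,\dots,d-1\}$; $f_m$ denotes a best $m$-term approximation of $f$ (keep $m$ coordinates of largest magnitude, set the rest to $0$); $f$ is $m$-sparse if it has at most $m$ nonzero entries. Construction of $\Phi$. Fix a sufficiently large constant $a$; put $m_k=m/a^k$ and use passes $k=0,1,\dots,K-1$ with $K=1+\lfloor\log_a m\rfloor$. Let $T_k=\lceil c_1(k+1)\log d\rceil$ and $r_k=\lceil c_2 m/2^k\rceil$, where $c_1,c_2$ depend only on $a$. The isolation matrix $A$ is the $0$-$1$ matrix obtained by stacking blocks $A^{(k)}_t$ ($0\le k<K$, $1\le t\le T_k$), each an $r_k\times d$ matrix in which every column contains exactly one $1$, placed in a uniformly random row, independently over all columns and all blocks (so each block is a uniformly random partition of the $d$ positions into $r_k$ parts; each row of $A$ is called a measurement). Let $L=\lceil\log_2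 d\rceil$. The bit test matrix $B$ has $L+1$ rows: row $0$ is all ones and, for $0\le i<L$, row $i+1$, denoted $\beta_i$, has a $1$ in column $j$ iff the $i$-th binary digit of $j$ is $1$. $\Phi$ is the row tensor product of $A$ and $B$: its rows are all componentwise products $\beta\alpha$ of a row $\beta$ of $B$ and a row $\alpha$ of $A$. Chaining Pursuit. For a row $\alpha$ of $A$ and a vector $g$, the measurement of $g$ by $\alpha$ consists of $c=\langle\alpha,g\rangle$ and $b(i)=\langle \alpha\beta_i,g\rangle$, $0\le i<L$ (entries of $\Phi g$). It is decoded into a position whose $i$-th binary digit is $1$ if $|b(i)|\ge|c-b(i)|$ and $0$ otherwise, and into the value $c$. The algorithm keeps an approximation $h$ (initially $0$) and the residual sketch $V-\Phi h$. In pass $k$: in each trial $t$, every row of $A^{(k)}_t$ is decoded from the residual sketch; for each decoded position the value of largest magnitude is kept, and the $m_k$ positions with largest kept magnitudes are retained. Positions retained in at least $9/10$ of the $T_k$ trials are selected; each receives the median of its estimated values over the trials; the resulting vector $\tilde f$ is added to $h$ (equivalently $\Phi\tilde f$ is subtracted from the residual sketch). After the last pass, Chaining Pursuit outputs the restriction of $h$ to its $m$ largest-magnitude entries. *)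

(* Defs.v *)
From HB Require Import structures.
From mathcomp Require Import all_boot all_order all_algebra.
From mathcomp Require Import boolp reals exp.

Set Implicit Arguments.
Unset Strict Implicit.
Unset Printing Implicit Defensive.

Import Order.TTheory GRing.Theory Num.Theory.

Local Open Scope ring_scope.

Definition l1norm (R : realType) (d : nat) (f : 'cV[R]_d) : R :=
  \sum_(j < d) `|f j 0|.

Definition nnz (R : realType) (d : nat) (f : 'cV[R]_d) : nat :=
  #|[set j : 'I_d | f j 0 != 0]|.

(* [Q] consists of [n] elements of [E] at which [|w|] is largest (all of [E] if
   it has fewer than [n] elements); ties may be broken in any way. *)
Definition largest (R : realType) (d n : nat) (E : {set 'I_d})
    (w : 'I_d -> R) (Q : {set 'I_d}) : Prop :=
  [/\ Q \subset E, #|Q| = minn n #|E| &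
      forall i j, i \in Q -> j \in E :\: Q -> `|w j| <= `|w i|].

Definition best_approx (R : realType) (d m : nat) (f g : 'cV[R]_d) : Prop :=
  exists2 Q : {set 'I_d}, largest m [set: 'I_d] (fun j => f j 0) Q &
    forall j, g j 0 = if j \in Q then f j 0 else 0.

(* For an even number of values, every point between the two middle ones is a
   median. *)
Definition is_median (R : realType) (s : seq R) (x : R) : Prop :=
  (size s <= (count (fun y => (y <= x)%R) s).*2)%N /\
  (size s <= (count (fun y => (x <= y)%R) s).*2)%N.

Definition uniform_prob (R : realType) (W : finType) (E : W -> Prop) : R :=
  #|[set w | `[< E w >]]|%:R / #|W|%:R.

(** * The measurement matrix *)

Record design := Design {
  dim : nat;              (* d *)
  sparsity : nat;         (* m *)
  npass : nat;            (* K *)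
  ntrial : nat -> nat;    (* T_k *)
  npart : nat -> nat;     (* r_k *)
  nkeep : nat -> nat      (* m_k *)
}.

(* Logarithms are natural unless a base is given.  At most [m / a ^ k] positions
   are to be retained, hence the rounding of [m_k] towards zero; for [k < K] one
   has [1 <= m / a ^ k]. *)
Definition chaining_design (R : realType) (a c1 c2 : R) (d m : nat) : design :=
  {| dim := d;
     sparsity := m;
     npass := (Num.truncn (ln (m%:R : R) / ln a)).+1;
     ntrial := fun k => `|Num.ceil (c1 * k.+1%:R * ln (d%:R : R))|%N;
     npart := fun k => `|Num.ceil (c2 * m%:R / 2 ^+ k)|%N;
     nkeep := fun k => Num.truncn (m%:R / a ^+ k) |}.

(* [up_log 2 d] is the rounded up base 2 logarithm of [d]. *)
Definition nbits (D : design) : nat := up_log 2 (dim D).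

(* Pairs (k, t): the blocks of the isolation matrix. *)
Definition block (D : design) : finType :=
  {k : 'I_(npass D) & 'I_(ntrial D k)}.

(* Triples (k, t, n): the rows of the isolation matrix. *)
Definition arow (D : design) : finType :=
  {b : block D & 'I_(npart D (tag b))}.

Definition mkblock (D : design) (k : 'I_(npass D)) (t : 'I_(ntrial D k)) :
  block D := existT _ k t.

Definition mkrow (D : design) (b : block D) (n : 'I_(npart D (tag b))) :
  arow D := existT _ b n.

(* The sample space: [w b j] is the row of block [b] containing the unique [1]
   of column [j].  The uniform probability on this type makes these rows
   uniform and independent over all [b] and [j]. *)
Definition sample (D : design) : finType :=
  {dffun forall b : block D, {ffun 'I_(dim D) -> 'I_(npart D (tag b))}}.

Definition isolation_mx (R : realType) (D : design) (w : sample D) :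
    'M[R]_(#|arow D|, dim D) :=
  \matrix_(x, j) let: existT b n := enum_val x in (w b j == n)%:R.

Definition digit (j i : nat) : bool := odd (j %/ 2 ^ i)%N.

Definition bittest_mx (R : realType) (D : design) :
    'M[R]_((nbits D).+1, dim D) :=
  \matrix_(x, j) if unlift ord0 x is Some i then (digit j i)%:R else 1.

(* The row of index [mxvec_index p q] is the product of row [p] of [A] and
   row [q] of [B]. *)
Definition row_tensor (R : realType) (r s d : nat) (A : 'M[R]_(r, d))
    (B : 'M[R]_(s, d)) : 'M[R]_(r * s, d) :=
  \matrix_(x, j) mxvec (\matrix_(p, q) (B q j * A p j)) 0 x.

Notation nsketch D := (#|arow D| * (nbits D).+1)%N.

Definition Phi (R : realType) (D : design) (w : sample D) :
    'M[R]_(nsketch D, dim D) :=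
  row_tensor (isolation_mx R w) (bittest_mx R D).

(* The entry of a sketch that belongs to row [al] of the isolation matrix and
   row [i] of the bit test matrix. *)
Definition entry (D : design) (al : arow D) (i : 'I_(nbits D).+1) :
    'I_(nsketch D) := mxvec_index (enum_rank al) i.

(** * Chaining Pursuit *)

(* In the definitions below [V] is the current residual sketch. *)
Definition value (R : realType) (D : design) (V : 'cV[R]_(nsketch D))
    (al : arow D) : R := V (entry al ord0) 0.

Definition bit_value (R : realType) (D : design) (V : 'cV[R]_(nsketch D))
    (al : arow D) (i : 'I_(nbits D)) : R := V (entry al (lift ord0 i)) 0.

Definition decoded_bit (R : realType) (c b : R) : bool := `|c - b| <= `|b|.

Definition position (R : realType) (D : design) (V : 'cV[R]_(nsketch D))
    (al : arow D) : nat :=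
  (\sum_(i < nbits D) decoded_bit (value V al) (bit_value V al i) * 2 ^ i)%N.

(* When [d] is not a power of 2, a row may decode into a number [>= d]; such a
   number is not a position and the row is ignored. *)
Definition decoded (R : realType) (D : design) (V : 'cV[R]_(nsketch D))
    (b : block D) : {set 'I_(dim D)} :=
  [set j : 'I_(dim D) | [exists n, position V (mkrow (b := b) n) == j]].

Definition kept_value (R : realType) (D : design) (V : 'cV[R]_(nsketch D))
    (b : block D) (j : 'I_(dim D)) (x : R) : Prop :=
  (exists2 n, position V (mkrow (b := b) n) = j & value V (mkrow n) = x) /\
  (forall n, position V (mkrow (b := b) n) = j ->
     `|value V (mkrow n)| <= `|x|).

(* [ft] is a possible outcome of pass [k]: [v t j] is the value kept for [j]
   and [Q t] the set of positions retained in trial [t]. *)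
Definition pass (R : realType) (D : design) (k : 'I_(npass D))
    (V : 'cV[R]_(nsketch D)) (ft : 'cV[R]_(dim D)) : Prop :=
  exists (v : 'I_(ntrial D k) -> 'I_(dim D) -> R)
         (Q : 'I_(ntrial D k) -> {set 'I_(dim D)}),
  [/\ forall t j, j \in decoded V (mkblock t) ->
        kept_value V (mkblock t) j (v t j),
      forall t, largest (nkeep D k) (decoded V (mkblock t)) (v t) (Q t) &
      forall j,
        if (9 * ntrial D k <= 10 * #|[set t | j \in Q t]|)%N
        then is_median [seq v t j | t <- enum 'I_(ntrial D k) & j \in Q t]
               (ft j 0)
        else ft j 0 = 0].

(* [fhat] is a possible output of Chaining Pursuit on the sketch [V]; [h k] is
   the approximation at the beginning of pass [k]. *)
Definition chaining_pursuit (R : realType) (D : design)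
    (P : 'M[R]_(nsketch D, dim D)) (V : 'cV[R]_(nsketch D))
    (fhat : 'cV[R]_(dim D)) : Prop :=
  exists h : nat -> 'cV[R]_(dim D),
  [/\ h 0%N = 0,
      forall k : 'I_(npass D), pass k (V - P *m h k) (h k.+1 - h k) &
      best_approx (sparsity D) (h (npass D)) fhat].

(** * A timed implementation

    A timed computation carries the number of steps it takes on a unit-cost
    real RAM: arithmetic and comparisons on reals and on machine words (loop
    counters, positions, binary digits, addresses) and accesses to one memory
    cell take O(1) steps.  Given [b] and [j], the row [w b j] containing the
    [1] of column [j] of block [b] is obtained in one step (random access to
    the columns of the isolation matrix).  Traversing a list takes one step
    per cell.  The design parameters are part of the input. *)

Definition timed (A : Type) : Type := (A * nat)%type.

Definition charge (A : Type) (n : nat) (x : A) : timed A := (x, n).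

Definition ret (A : Type) (x : A) : timed A := charge 0 x.

Definition step (A : Type) (x : A) : timed A := charge 1 x.

Definition bind (A B : Type) (p : timed A) (q : A -> timed B) : timed B :=
  ((q p.1).1, (p.2 + (q p.1).2)%N).

Notation "'let*' x := p 'in' q" := (bind p (fun x => q))
  (at level 200, x name, p at level 200, q at level 200).

Fixpoint tfold (A X : Type) (body : A -> X -> timed A) (acc : A) (xs : seq X) :
    timed A :=
  if xs is x :: xs' then
    let* acc' := body acc x in
    let* acc' := step acc' in
    tfold body acc' xs'
  else step acc.

Fixpoint tmap (X Y : Type) (body : X -> timed Y) (xs : seq X) :
    timed (seq Y) :=
  if xs is x :: xs' then
    let* y := body x in
    let* ys := tmap body xs' in
    step (y :: ys)
  else step [::].

Definition tpmap (X Y : Type) (body : X -> timed (option Y)) (xs : seq X) :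
    timed (seq Y) :=
  let* ys := tmap body xs in
  charge (size ys) (pmap id ys).

(* Bottom-up merge sort. *)
Definition tmerge (X : Type) (le : rel X) (s1 s2 : seq X) : timed (seq X) :=
  charge (size s1 + size s2).+1 (merge le s1 s2).

Fixpoint merge_pairs (X : Type) (le : rel X) (ss : seq (seq X)) :
    timed (seq (seq X)) :=
  if ss is s1 :: s2 :: ss' then
    let* s := tmerge le s1 s2 in
    let* ss'' := merge_pairs le ss' in
    step (s :: ss'')
  else step ss.

(* [fuel] only serves to make the recursion structural. *)
Fixpoint merge_rounds (X : Type) (le : rel X) (fuel : nat) (ss : seq (seq X)) :
    timed (seq X) :=
  match fuel, ss with
  | fuel'.+1, _ :: _ :: _ =>
      let* ss' := merge_pairs le ss in merge_rounds le fuel' ss'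
  | _, _ => step (head [::] ss)
  end.

Definition tsort (X : Type) (le : rel X) (s : seq X) : timed (seq X) :=
  let* ss := tmap (fun x => step [:: x]) s in
  merge_rounds le (size s) ss.

(* Groups consecutive items with the same key. *)
Fixpoint runs (I : eqType) (X : Type) (s : seq (I * X)) :
    timed (seq (I * seq X)) :=
  if s is (j, x) :: s' then
    let* gs := runs s' in
    step (if gs is (j', xs) :: gs' then
            if j == j' then (j, x :: xs) :: gs' else (j, [:: x]) :: gs
          else [:: (j, [:: x])])
  else step [::].

Definition ttake (X : Type) (n : nat) (s : seq X) : timed (seq X) :=
  charge (size (take n s)).+1 (take n s).

(* Sparse vectors are stored as lists of pairs (position, value). *)
Notation spikes R D := (seq ('I_(dim D) * R)).

Definition by_position_magnitude (R : realType) (D : design) :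
    rel ('I_(dim D) * R) :=
  fun e1 e2 =>
    (e1.1 < e2.1)%N || (e1.1 == e2.1) && (`|e2.2| <= `|e1.2|).

Definition by_position_value (R : realType) (D : design) :
    rel ('I_(dim D) * R) :=
  fun e1 e2 => (e1.1 < e2.1)%N || (e1.1 == e2.1) && (e1.2 <= e2.2).

Definition by_magnitude (R : realType) (D : design) : rel ('I_(dim D) * R) :=
  fun e1 e2 => `|e2.2| <= `|e1.2|.

Definition tread (R : realType) (D : design) (V : 'cV[R]_(nsketch D))
    (al : arow D) (i : 'I_(nbits D).+1) : timed R :=
  step (V (entry al i) 0).

Definition twrite (R : realType) (D : design) (V : 'cV[R]_(nsketch D))
    (al : arow D) (i : 'I_(nbits D).+1) (x : R) :
    timed 'cV[R]_(nsketch D) :=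
  step (\col_z if z == entry al i then x else V z 0).

Definition tdecode (R : realType) (D : design) (V : 'cV[R]_(nsketch D))
    (al : arow D) : timed (option ('I_(dim D) * R)) :=
  let* c := tread V al ord0 in
  let* p := tfold (fun (p : nat) (i : 'I_(nbits D)) =>
                   let* b := tread V al (lift ord0 i) in
                   step (p.*2 + decoded_bit c b)%N)
                0%N (rev (enum 'I_(nbits D))) in
  step (omap (fun j => (j, c)) (insub p : option 'I_(dim D))).

Definition ttrial (R : realType) (D : design) (V : 'cV[R]_(nsketch D))
    (b : block D) : timed (spikes R D) :=
  let* es := tpmap (fun n => tdecode V (mkrow n))
                 (enum 'I_(npart D (tag b))) in
  let* es := tsort (@by_position_magnitude R D) es in
  let* gs := runs es in
  let* es := tmap (fun g => step (g.1, head 0 g.2)) gs in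
  let* es := tsort (@by_magnitude R D) es in
  ttake (nkeep D (tag b)) es.

Definition tpass (R : realType) (D : design) (V : 'cV[R]_(nsketch D))
    (k : 'I_(npass D)) : timed (spikes R D) :=
  let* es := tfold (fun (acc : spikes R D) t =>
                    let* es := ttrial V (mkblock t) in
                    charge (size es).+1 (es ++ acc))
                 [::] (enum 'I_(ntrial D k)) in
  let* es := tsort (@by_position_value R D) es in
  let* gs := runs es in
  tpmap (fun g : 'I_(dim D) * seq R =>
           let* n := charge (size g.2).+1 (size g.2) in
           if (9 * ntrial D k <= 10 * n)%N
           then charge n.+1 (Some (g.1, nth 0 g.2 n./2))
           else step None) gs.

(* Subtracts [Phi *m f] from the sketch [V], where [f] has the single nonzero
   entry [e.2] at position [e.1]. *)
Definition tsubtract (R : realType) (D : design) (w : sample D)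
    (V : 'cV[R]_(nsketch D)) (e : 'I_(dim D) * R) :
    timed 'cV[R]_(nsketch D) :=
  tfold (fun V (b : block D) =>
    let* n := step (w b e.1) in
    tfold (fun V (i : 'I_(nbits D).+1) =>
      let* on :=
        step (if unlift ord0 i is Some i' then digit e.1 i' else true) in
      if on then
        let* x := tread V (mkrow n) i in
        twrite V (mkrow n) i (x - e.2)
      else step V)
    V (enum 'I_(nbits D).+1))
  V (enum (block D)).

Definition run_chaining_pursuit (R : realType) (D : design) (w : sample D)
    (V : 'cV[R]_(nsketch D)) : timed (spikes R D) :=
  let* Vh := tfold (fun (Vh : 'cV[R]_(nsketch D) * spikes R D) k =>
                    let* ft := tpass Vh.1 k in
                    let* V' := tfold (tsubtract w) Vh.1 ft in
                    charge (size ft).+1 (V', ft ++ Vh.2))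
                 (V, [::]) (enum 'I_(npass D)) in
  let* es := tsort (@by_position_value R D) Vh.2 in
  let* gs := runs es in
  let* es := tmap (fun g : 'I_(dim D) * seq R =>
                   let* x := tfold (fun x y => step (x + y)) 0 g.2 in
                   step (g.1, x)) gs in
  let* es := tsort (@by_magnitude R D) es in
  ttake (sparsity D) es.

Definition vector_of (R : realType) (D : design) (es : spikes R D) :
    'cV[R]_(dim D) :=
  \col_j \sum_(e <- es | e.1 == j) e.2.

(* Main.v *)
(* In each trial the positions are thrown into buckets, and a row decodes
   correctly as soon as its bucket holds one spike that outweighs everything
   else in it.  Give the spikes weight 1 and every other position its magnitude
   divided by a threshold lam.  The total excess over 1 of the bucket weights is a
   convex function of the weights, so it is at most its value at some 0-1 vector,
   that is, the number of collisions inside a set J of positions.  Hence one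
   property of the random partitions handles all signals at once: no set J of
   O((k + 1) m_k) positions has more than m_k T_k / 2048 collisions in the trials
   of pass k.  For fixed J each collision costs a factor |J| / r_k, which beats
   the union bound over the sets J.

   On this event the invariant of the loop is that, off a head of about m_k
   positions, the residual is O(s / m_k) in every position and O((k + 1) s) in
   the l1 norm, for any s above the error of the best m-term approximation.  In
   pass k, few spikes of the head are missed and few estimates are wrong, because
   both are paid for by bad buckets; these positions form the next head.  Every
   other position selected or left over contributes O(s / m_k) to the noise.
   Letting s tend to the optimal error gives the bound, including exact recovery
   when this error vanishes. *)
Require Import Defs.
From HB Require Import structures.
From mathcomp Require Import all_boot all_order all_algebra.
From mathcomp Require Import boolp reals exp.
From mathcomp Require Import sequences ring lra zify.

Set Implicit Arguments.
Unset Strict Implicit.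
Unset Printing Implicit Defensive.

Import Order.TTheory GRing.Theory Num.Theory.
Import Defs.

Local Open Scope ring_scope.

(** * Bucket loads *)

Section Excess.
Variables (R : realFieldType) (I B : finType) (P : B -> {set I}).
Implicit Types u v : I -> R.

(** The signal may be chosen after [Phi], and the residual entering a pass depends on [Phi] too, so
    no probability can be attached to one given vector. All randomness therefore sits in a condition
    on the partitions alone; what follows from it is deterministic. Two growths in k shape the
    parameters. The noise gains a fixed multiple of s in each pass, so J must be allowed O((k + 1)
    m_k) elements; the resulting d^|J| choices of J are paid for by the factor k + 1 in T_k. The
    expected number of collisions per trial is of order |J|^2 / r_k and must stay below a small
    multiple of m_k. With a = 8, r_k is at least c2 4^k m_k (m_k unrounded), and 4^k >= (k + 1)^2
    absorbs the growth of |J|^2. The fraction 1 / 2048 is small enough for the new head to have at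
    most m_k / 16 positions, half of the next level. The factor one half is what survives the
    rounding of m_(k+1), and it makes the head empty once the level drops below 1. *)

Definition excess u : R :=
  \sum_(x : B) Num.max 0 (\sum_(j in P x) u j - 1).

Lemma le_excess u v : (forall j, u j <= v j) -> excess u <= excess v.
Proof.
move=> le_uv; apply: ler_sum => x _; rewrite ge_max le_max lexx /=.
by rewrite le_max lerD2r ler_sum ?orbT.
Qed.

Definition transfer (i k : I) u (p : R) : I -> R :=
  fun j => u j + p * ((j == i)%:R - (j == k)%:R).

Lemma sum_transfer i k u p : \sum_j transfer i k u p j = \sum_j u j.
Proof.
rewrite big_split /= -mulr_sumr sumrB.
have E l : \sum_(j : I) ((j == l)%:R : R) = 1.
  by rewrite (bigD1 l) //= eqxx big1 ?addr0 // => j /negbTE ->.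
by rewrite !E subrr mulr0 addr0.
Qed.

(** Convexity along a line: [u] is the average of the two transfers with weights q / (p + q) and p /
    (p + q), and each summand is the maximum of two affine functions. *)
Lemma excess_transfer i k u (p q : R) : 0 <= p -> 0 <= q ->
  (p + q) * excess u <=
  q * excess (transfer i k u p) + p * excess (transfer i k u (- q)).
Proof.
move=> p0 q0; rewrite /excess !mulr_sumr -big_split /=.
apply: ler_sum => x _; rewrite !big_split -!mulr_sumr /=.
set D := \sum_(j in P x) (_ - _); set L := \sum_(j in P x) u j.
have m0 (y : R) : 0 <= Num.max 0 y by rewrite le_max lexx.
have my (y : R) : y <= Num.max 0 y by rewrite le_max lexx orbT.
have := m0 (L + p * D - 1); have := my (L + p * D - 1).
have := m0 (L + - q * D - 1); have := my (L + - q * D - 1).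
set A1 := Num.max 0 (L + p * D - 1); set A2 := Num.max 0 (L + - q * D - 1).
move=> ? ? ? ?; rewrite maxEle; case: ifP => _; last by nra.
nra.
Qed.

Definition fractional u := [set j | (0 < u j) && (u j < 1)].

Lemma fractional_transfer i k u p : i != k -> i \in fractional u ->
    k \in fractional u ->
    let v := transfer i k u p in
    (forall j, 0 <= u j <= 1) -> 0 <= v i <= 1 -> 0 <= v k <= 1 ->
    [|| v i == 0, v i == 1, v k == 0 | v k == 1] ->
  (forall j, 0 <= v j <= 1) /\ (#|fractional v| < #|fractional u|)%N.
Proof.
move=> nik iF kF v u01 vi vk ends.
have vE j : j != i -> j != k -> v j = u j.
  by move=> /negbTE ji /negbTE jk; rewrite /v /transfer ji jk subrr mulr0 addr0.
split=> [j|].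
  by have [->//|ji] := eqVneq j i; have [->//|jk] := eqVneq j k; rewrite vE.
apply: proper_card; apply/properP; split.
  apply/subsetP => j; have [->//|ji] := eqVneq j i.
  by have [->//|jk] := eqVneq j k; rewrite !inE vE.
have [viE|viE] := boolP ((v i == 0) || (v i == 1)).
  by exists i => //; rewrite inE; case/orP: viE => /eqP ->; rewrite ltxx ?andbF.
exists k => //; rewrite inE; move: ends viE.
by case: eqP => //= _; case: eqP => //= _ /orP[] /eqP -> _; rewrite ltxx ?andbF.
Qed.

(* [excess] is convex, so over the polytope of weights it is largest at a
   vertex: as long as two weights are fractional, mass can be moved from one of
   them to the other, in one of the two directions, without decreasing it. *)
Lemma excess_le_vertices (N : nat) (Q : R) :
    (forall J : {set I}, (#|J| <= N)%N -> excess (fun j => (j \in J)%:R) <= Q) ->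
  forall u, (forall j, 0 <= u j <= 1) -> \sum_j u j <= N%:R -> excess u <= Q.
Proof.
move=> HQ u; have [c] := ubnP #|fractional u|; elim: c u => // c IHc u.
rewrite ltnS => cu u01 uN.
have u1 j : j \notin fractional u -> u j = (u j == 1)%:R.
  rewrite inE; have /andP[] := u01 j; rewrite le_eqVlt => /orP[/eqP <- _ _|->].
    by rewrite eq_sym oner_eq0.
  by rewrite le_eqVlt => /orP[/eqP -> _|->//]; rewrite eqxx.
have [F0|[i iF]] := set_0Vmem (fractional u).
  pose J := [set j | u j == 1].
  have uE j : u j = (j \in J)%:R by rewrite inE {1}u1 // F0 inE.
  apply: le_trans (HQ J _); first by apply: le_excess => j; rewrite uE.
  rewrite -(ler_nat R) (le_trans _ uN) // (eq_bigr _ (fun j _ => uE j)).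
  by rewrite -natr_sum -big_mkcond /= sum1_card.
have /andP[i0 i1] : (0 < u i) && (u i < 1) by move: iF; rewrite inE.
have [Fi|[k]] := set_0Vmem (fractional u :\ i).
  pose J := i |: [set j | u j == 1].
  have uE j : j != i -> u j = (j \in J)%:R.
    move=> ji; rewrite !inE (negbTE ji) /= -u1 //.
    apply/negP => jF; suff : j \in fractional u :\ i by rewrite Fi inE.
    by rewrite !inE ji /=; rewrite inE in jF.
  apply: le_trans (HQ J _); first apply: le_excess => j.
    have [->|/uE ->//] := eqVneq j i; rewrite !inE eqxx /=; exact: ltW.
  (* Rounding up the only fractional weight adds less than 1 to the sum, and a cardinality below N +
     1 is at most N. *)
  have : \sum_j ((j \in J)%:R : R) < N%:R + 1.
    apply: le_lt_trans (_ : \sum_j u j + (1 - u i) < _); last by lra.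
    rewrite (bigD1 i) //= [\sum_j u j](bigD1 i) //= !inE eqxx /=.
    rewrite (eq_bigr u); last by move=> j /uE ->.
    lra.
  rewrite -natr_sum -big_mkcond /= sum1_card natr1 ltr_nat => ?; lia.
rewrite !inE => /andP[ki /andP[k0 k1]].
have kF : k \in fractional u by rewrite inE k0.
rewrite eq_sym in ki.
(* The largest shifts in the two directions: each stops when one of the two weights reaches 0 or 1,
   so the number of fractional weights drops. *)
pose p := Num.min (u k) (1 - u i); pose q := Num.min (u i) (1 - u k).
have p0 : 0 < p by rewrite lt_min k0; lra.
have q0 : 0 < q by rewrite lt_min i0; lra.
have step s : 0 <= transfer i k u s i <= 1 -> 0 <= transfer i k u s k <= 1 ->
    [|| transfer i k u s i == 0, transfer i k u s i == 1,
        transfer i k u s k == 0 | transfer i k u s k == 1] ->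
    excess (transfer i k u s) <= Q.
  move=> hi hk ends; have [v01 lt] := fractional_transfer ki iF kF u01 hi hk ends.
  by apply: IHc => //; [exact: leq_trans lt cu|rewrite sum_transfer].
have tri s : transfer i k u s i = u i + s.
  by rewrite /transfer eqxx (negbTE ki) subr0 mulr1.
have trk s : transfer i k u s k = u k - s.
  by rewrite /transfer eqxx eq_sym (negbTE ki) sub0r mulrN1.
have Qp : excess (transfer i k u p) <= Q.
  rewrite /p; have [h|h] := leP (u k) (1 - u i); apply: step; rewrite ?tri ?trk.
  - by apply/andP; split; lra.
  - by apply/andP; split; lra.
  - by rewrite subrr eqxx !orbT.
  - by apply/andP; split; lra.
  - by apply/andP; split; lra.
  - by rewrite addrCA subrr addr0 eqxx !orbT.
have Qq : excess (transfer i k u (- q)) <= Q.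
  rewrite /q; have [h|h] := leP (u i) (1 - u k); apply: step; rewrite ?tri ?trk.
  - by apply/andP; split; lra.
  - by apply/andP; split; lra.
  - by rewrite subrr eqxx.
  - by apply/andP; split; lra.
  - by apply/andP; split; lra.
  - by rewrite opprK addrCA subrr addr0 eqxx !orbT.
have := excess_transfer i k u (ltW p0) (ltW q0); nra.
Qed.
End Excess.

(** * Decoding one row *)

Section Sketch.
Variables (R : realType) (D : design) (w : sample D).
Implicit Types (g : 'cV[R]_(dim D)) (b : block D).

Definition bucket b (n : 'I_(npart D (tag b))) : {set 'I_(dim D)} :=
  [set j | w b j == n].

Lemma Phi_entry b n i j :
  Phi R w (entry (@mkrow D b n) i) j =
  (w b j == n)%:R * (if unlift ord0 i is Some i' then digit j i' else true)%:R.
Proof.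
rewrite /Phi /row_tensor /entry mxE mxvecE !mxE enum_rankK /= mulrC.
by case: unliftP.
Qed.

Lemma value_Phi g b n :
  value (Phi R w *m g) (@mkrow D b n) = \sum_(j in bucket n) g j 0.
Proof.
rewrite /value mxE [RHS]big_mkcond; apply: eq_bigr => j _.
by rewrite Phi_entry unlift_none mulr1 inE; case: eqP; rewrite ?mul1r ?mul0r.
Qed.

Lemma bit_value_Phi g b n i :
  bit_value (Phi R w *m g) (@mkrow D b n) i =
  \sum_(j in bucket n) (digit j i)%:R * g j 0.
Proof.
rewrite /bit_value mxE [RHS]big_mkcond. apply: eq_bigr => j _.
by rewrite Phi_entry liftK inE; case: eqP; rewrite ?mul1r ?mul0r.
Qed.

Lemma sum_digits L j : (j < 2 ^ L)%N -> (\sum_(i < L) digit j i * 2 ^ i)%N = j.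
Proof.
elim: L j => [|L IHL] j; first by rewrite ltnS leqn0 big_ord0 => /eqP ->.
rewrite big_ord_recl /= muln1 expnS => jL.
rewrite (eq_bigr (fun i : 'I_L => 2 * (digit (j %/ 2) i * 2 ^ i))%N); last first.
  move=> i _; rewrite /bump /= add1n /digit expnS divnMA; lia.
rewrite -big_distrr /= IHL; last by rewrite ltn_divLR // mulnC.
by rewrite /digit expn0 divn1 addnC divn2 mul2n addnC odd_double_half.
Qed.

Lemma digit_inj_position V (al : arow D) (j : 'I_(dim D)) :
    (forall i : 'I_(nbits D),
       decoded_bit (value V al) (bit_value V al i) = digit j i) ->
  position (R := R) V al = j.
Proof.
move=> H; rewrite -[RHS](@sum_digits (nbits D)).
  by apply: eq_bigr => i _; rewrite H.
by apply: leq_trans (ltn_ord j) _; rewrite up_logP.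
Qed.

(** Every other entry of the bucket counts in exactly one of b(i) and c - b(i). So the noises A and
    B of the two together stay below the entry at j, and the side that contains j wins the
    comparison for each digit. *)
Lemma decode_dominant g b n (j : 'I_(dim D)) : j \in bucket n ->
    \sum_(i in bucket n | i != j) `|g i 0| < `|g j 0| ->
  position (Phi R w *m g) (@mkrow D b n) = j.
Proof.
move=> jn dom; apply: digit_inj_position => l.
rewrite /decoded_bit value_Phi bit_value_Phi -sumrB.
rewrite (bigD1 j) //= [X in _ <= `|X|](bigD1 j) //=.
set A := \sum_(i in _ | _) (g _ _ - _); set B := \sum_(i in _ | _) (_ * _).
have AB : `|A| + `|B| < `|g j 0|.
  apply: le_lt_trans dom.
  apply: le_trans (lerD (ler_norm_sum _ _ _) (ler_norm_sum _ _ _)) _.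
  rewrite -big_split /=; apply: ler_sum => i _.
  by case: digit; rewrite ?mul1r ?mul0r ?subrr ?subr0 normr0 ?add0r ?addr0.
case: (digit j l); rewrite ?mul1r ?mul0r ?subrr ?subr0 ?add0r.
  have := ler_normD (g j 0 + B) (- B); rewrite addrK normrN => ?; lra.
apply/negbTE; rewrite -ltNge.
have := ler_normD (g j 0 + A) (- A); rewrite addrK normrN => ?; lra.
Qed.

End Sketch.

(** * One pass *)

Section Median.
Variable R : realType.

(** At least half of the values lie on the side of the median that points away from y, and those are
    at least as far from y as the median. *)
Lemma median_error (s : seq R) (x y e : R) : is_median s x -> e <= `|x - y| ->
  (size s <= (count (fun z => (e <= `|z - y|)%R) s).*2)%N.
Proof.
case=> lex gex; have [yx|xy] := leP y x => exy.
  apply: leq_trans gex _; rewrite leq_double; apply: sub_count => z /= xz.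
  by move: exy; rewrite !ger0_norm ?subr_ge0 //; lra.
apply: leq_trans lex _; rewrite leq_double; apply: sub_count => z /= zx.
by move: exy; rewrite !ler0_norm ?subr_le0 //; lra.
Qed.

Lemma count_enum (I : finType) (P : pred I) : count P (enum I) = #|[set t | P t]|.
Proof.
rewrite cardsE cardE -size_filter /enum_mem -filter_predI; congr size.
by apply: eq_filter => t; rewrite /= andbT.
Qed.

Lemma sum_card_exchange (T1 T2 : finType) (P : T1 -> {set T2}) (A : {set T2}) :
  (\sum_(j in A) #|[set t | j \in P t]| = \sum_t #|P t :&: A|)%N.
Proof.
under eq_bigr => j _ do rewrite -sum1_card big_mkcond /=.
rewrite exchange_big /=; apply: eq_bigr => t _.
rewrite -sum1_card [RHS]big_mkcond [LHS]big_mkcond /=; apply: eq_bigr => j _.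
by rewrite !inE andbC; do 2 case: (_ \in _).
Qed.

End Median.

Section Pass.
Variables (R : realType) (D : design) (w : sample D) (k : 'I_(npass D)).
Variables (g : 'cV[R]_(dim D)) (lam : R) (S : {set 'I_(dim D)}).
Hypothesis lam_gt0 : 0 < lam.

Notation T := (ntrial D k).
Notation V := (Phi R w *m g).

(** The minimum with 1 keeps the weights in the cube on which [excess_le_vertices] applies. An entry
    off [S] that reaches [lam] is thus treated as one more spike. *)
Definition weight j : R :=
  if j \in S then 1 else Num.min 1 (`|g j 0| / lam).

Lemma weight01 j : 0 <= weight j <= 1.
Proof.
rewrite /weight; case: ifP => _; first by rewrite ler01 lexx.
by rewrite le_min ler01 divr_ge0 //= ?ge_min ?lexx // ltW.
Qed.

Lemma weight_lt1 j : weight j < 1 -> `|g j 0| = lam * weight j.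
Proof.
rewrite /weight; case: ifP => _; first by rewrite ltxx.
by rewrite gt_min ltxx /= minEle => h; rewrite leNgt h /= mulrC divfK // gt_eqF.
Qed.

Lemma weight_spike j : lam <= `|g j 0| -> weight j = 1.
Proof.
rewrite /weight; case: ifP => // _ h; rewrite minEle ler_pdivlMr // mul1r.
by rewrite h.
Qed.

Definition mass (b : block D) n : R := \sum_(j in bucket w (b := b) n) weight j.

(* A bucket that is not bad holds either one spike (weight 1) and noise of total
   size below [lam / 2], or only noise, of total size below [3 / 2 * lam]. *)
Definition bad (b : block D) n : bool := 3 / 2 <= mass (b := b) n.

(** Beside the spike there is weight below 1 / 2 left. This excludes a second spike, so all other
    magnitudes are [lam] times their weights. *)
Lemma good_rest (b : block D) n j : ~~ bad (b := b) n -> j \in bucket w n ->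
    weight j = 1 ->
  \sum_(i in bucket w n | i != j) `|g i 0| < lam / 2.
Proof.
rewrite -ltNge /mass => good jn wj.
have rest : \sum_(i in bucket w n | i != j) weight i < 1 / 2.
  by move: good; rewrite (bigD1 j) //= wj; lra.
apply: (@le_lt_trans _ _ (lam * \sum_(i in bucket w n | i != j) weight i)).
  rewrite mulr_sumr; apply: ler_sum => i iP; rewrite weight_lt1 //.
  suff : weight i <= \sum_(i in bucket w n | i != j) weight i by lra.
  rewrite (bigD1 i) //= lerDl sumr_ge0 // => l _.
  by case/andP: (weight01 l).
by rewrite (lt_le_trans (_ : _ < lam * (1 / 2))) ?ltr_pM2l // mul1r.
Qed.

Lemma good_value (b : block D) n j : ~~ bad (b := b) n -> j \in bucket w n ->
    weight j = 1 -> `|value V (mkrow n) - g j 0| < lam / 2.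
Proof.
move=> good jn wj; apply: le_lt_trans (good_rest good jn wj).
by rewrite value_Phi (bigD1 j) //= addrAC subrr add0r ler_norm_sum.
Qed.

Lemma good_position (b : block D) n j : ~~ bad (b := b) n -> j \in bucket w n ->
    lam <= `|g j 0| -> position V (mkrow n) = j.
Proof.
move=> good jn gj; apply: decode_dominant => //.
apply: lt_trans (good_rest good jn (weight_spike gj)) _; have := lam_gt0; lra.
Qed.

(** A spike of size at least [lam / 2] dominates its good bucket and is decoded correctly. In all
    other good buckets the decoded position may be false, but then the value is too small to do
    harm. *)
Lemma good_decode (b : block D) n : ~~ bad (b := b) n ->
  (exists2 j : 'I_(dim D), position V (mkrow n) = j &
     `|value V (mkrow n) - g j 0| < lam / 2) \/
  `|value V (mkrow n)| < 3 / 2 * lam.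
Proof.
move=> good.
have [[j /andP[jn /eqP wj]]|no] :=
    altP (@existsP _ (fun j => (j \in bucket w n) && (weight j == 1))).
  have [gj|gj] := leP (lam / 2) `|g j 0|.
    left; exists j; last exact: good_value.
    by apply: decode_dominant => //; apply: lt_le_trans (good_rest good jn wj) _.
  right; have := good_value good jn wj.
  have := ler_normD (value V (mkrow n) - g j 0) (g j 0); rewrite subrK; have := lam_gt0; lra.
right; rewrite value_Phi.
apply: le_lt_trans (ler_norm_sum _ _ _) _.
apply: (@le_lt_trans _ _ (lam * mass n)).
  rewrite mulr_sumr; apply: ler_sum => j jn; rewrite weight_lt1 //.
  move: no; rewrite negb_exists => /forallP /(_ j); rewrite jn /= => wj.
  by rewrite lt_neqAle wj; case/andP: (weight01 j).
by rewrite mulrC ltr_pM2r // ltNge.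
Qed.

Definition bad_buckets (t : 'I_T) := [set n | bad (b := mkblock t) n].

Definition bad_spikes (t : 'I_T) :=
  [set j | (weight j == 1) && bad (w (mkblock t) j)].

Definition from_bad (t : 'I_T) :=
  [set j : 'I_(dim D) | [exists n, bad n && (position V (mkrow (b := mkblock t) n) == j)]].

Lemma card_from_bad t : (#|from_bad t| <= #|bad_buckets t|)%N.
Proof.
have [->|[j0 _]] := set_0Vmem (from_bad t); first by rewrite cards0.
pose q n := insubd j0 (position V (mkrow (b := mkblock t) n)).
suff /subset_leq_card h : from_bad t \subset q @: bad_buckets t.
  exact: leq_trans h (leq_imset_card _ _).
apply/subsetP => j; rewrite inE => /existsP[n /andP[bn /eqP nj]].
apply/imsetP; exists n; first by rewrite inE.
by apply: val_inj; rewrite /q nj val_insubd ltn_ord.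
Qed.

Variables (v : 'I_T -> 'I_(dim D) -> R) (Q : 'I_T -> {set 'I_(dim D)}).
Hypothesis keptP : forall t j, j \in decoded V (mkblock t) ->
  kept_value V (mkblock t) j (v t j).
Hypothesis QP : forall t, largest (nkeep D k) (decoded V (mkblock t)) (v t) (Q t).

(** The bucket of j itself decodes to j with error below [lam / 2]. Other rows that decode to j can
    only raise the kept magnitude. *)
Lemma good_kept t j : j \in decoded V (mkblock t) -> lam <= `|g j 0| ->
  j \notin bad_spikes t -> `|g j 0| - lam / 2 < `|v t j|.
Proof.
move=> jE gj; rewrite inE weight_spike // eqxx /= => good.
have jn : j \in bucket w (w (mkblock t) j) by rewrite inE.
have [_ /(_ _ (good_position good jn gj)) le] := keptP jE.
apply: lt_le_trans le.
have := good_value good jn (weight_spike gj); rewrite distrC.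
have := ler_normD (g j 0 - value V (mkrow (w (mkblock t) j))) (value V (mkrow (w (mkblock t) j))).
rewrite subrK; lra.
Qed.

Lemma good_decoded t j : lam <= `|g j 0| -> j \notin bad_spikes t ->
  j \in decoded V (mkblock t).
Proof.
move=> gj; rewrite inE weight_spike // eqxx /= => good.
have jn : j \in bucket w (w (mkblock t) j) by rewrite inE.
by rewrite inE; apply/existsP; exists (w (mkblock t) j); apply/eqP/good_position.
Qed.

Lemma kept_cases t j : j \in decoded V (mkblock t) -> j \notin from_bad t ->
  `|v t j - g j 0| < lam / 2 \/ `|v t j| < 3 / 2 * lam.
Proof.
move=> jE jB; have [[n nj nv] _] := keptP jE.
have good : ~~ bad n.
  apply: contra jB => bn; rewrite inE; apply/existsP; exists n.
  by rewrite bn nj eqxx.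
have [[i ni iv]|vn] := good_decode good; last by right; rewrite -nv.
have ij : i = j by apply: ord_inj; rewrite -nj -ni.
by left; rewrite -nv -ij.
Qed.

Definition wrong t :=
  [set j in decoded V (mkblock t) | 4 * lam <= `|v t j - g j 0|].

(** Suppose that the kept value comes from a good row but is off by [4 * lam]. Then it is below
    [3 / 2 * lam], so the entry exceeds [5 / 2 * lam]; had its own bucket been good, a value above
    [2 * lam] would have been kept instead. *)
Lemma wrong_sub t : wrong t \subset from_bad t :|: bad_spikes t.
Proof.
apply/subsetP => j; rewrite inE => /andP[jE err]; rewrite in_setU -implyNb.
apply/implyP => jB; apply/negPn/negP => jS.
have [?|vs] := kept_cases jE jB; first by have := lam_gt0; lra.
have gj : 5 / 2 * lam < `|g j 0|.
  have := ler_normB (v t j) (g j 0); lra.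
by have := good_kept jE (_ : lam <= _) jS; have := lam_gt0; lra.
Qed.

Lemma card_wrong t : (#|wrong t| <= #|bad_buckets t| + #|bad_spikes t|)%N.
Proof.
apply: leq_trans (subset_leq_card (wrong_sub t)) _.
by apply: leq_trans (leq_card_setU _ _) _; rewrite leq_add2r card_from_bad.
Qed.

(* [X] bounds the signal off the head [S]: a large spike of [S] can be left
   out of the [nkeep D k] retained positions only if these include one that
   stems from a bad bucket, or if [S] has more than [nkeep D k] elements. *)
Lemma card_unretained t (X : R) p : 0 <= X ->
    (#|S| <= nkeep D k + p)%N -> (forall j, j \notin S -> `|g j 0| <= X) ->
  (#|[set j in S | (X + 2 * lam < `|g j 0|)%R && (j \notin Q t)]| <=
     p + #|bad_buckets t| + #|bad_spikes t|)%N.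
Proof.
move=> X0 Sp SX; set A := [set _ in _ | _].
rewrite -(cardsID (bad_spikes t) A) addnC leq_add ?subset_leq_card ?subsetIr //.
have [->|[j]] := set_0Vmem (A :\: bad_spikes t); first by rewrite cards0.
have [QE cQ top] := QP t.
rewrite in_setD [j \in A]inE => /andP[jB /and3P[jS gj jQ]].
have lj : lam <= `|g j 0| by have := lam_gt0; lra.
have jE := good_decoded lj jB.
have vj := good_kept jE lj jB.
have nQ : (nkeep D k <= #|Q t|)%N.
  have lt : (#|Q t| < #|decoded V (mkblock t)|)%N.
    by apply/proper_card/properP; split=> //; exists j.
  by move: lt; rewrite cQ gtn_min ltnn orbF leq_min => /ltnW ->; rewrite leqnn.
(* The unretained spike has a kept value above X + 3 / 2 lam. A retained position off [S] that stems
   from a good row has at most the larger of X + lam / 2 and 3 / 2 lam, so it cannot have displaced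
   the spike. *)
have sub : Q t \subset (S :&: Q t) :|: from_bad t.
  apply/subsetP => i iQ; rewrite in_setU in_setI iQ andbT -implyNb.
  apply/implyP => iS; apply/negPn/negP => iB.
  have iE := subsetP QE _ iQ.
  have vij : `|v t j| <= `|v t i| by apply: top; rewrite // inE jQ.
  have := SX i iS; have := lam_gt0.
  have [vi|vi] := kept_cases iE iB; last lra.
  have := ler_normD (v t i - g i 0) (g i 0); rewrite subrK; lra.
have := leq_trans (subset_leq_card sub) (leq_card_setU _ _).
have := card_from_bad t.
have AS : A :\: bad_spikes t \subset S :\: Q t.
  by apply/subsetP => i; rewrite !inE => /andP[_ /andP[-> /andP[_ ->]]].
have := subset_leq_card AS; have := cardsID (Q t) S; move: Sp nQ; clear.
move: #|S :&: Q t| #|S :\: Q t| #|A :\: bad_spikes t| #|from_bad t|.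
move: #|bad_buckets t| #|S| #|Q t| (nkeep D k) => a b c e f h i j; lia.
Qed.

Variable ft : 'cV[R]_(dim D).
Hypothesis ftP : forall j,
  if (9 * T <= 10 * #|[set t | j \in Q t]|)%N
  then is_median [seq v t j | t <- enum 'I_T & j \in Q t] (ft j 0)
  else ft j 0 = 0.

Definition selected := [set j | (9 * T <= 10 * #|[set t | j \in Q t]|)%N].

Definition misjudged := [set j in selected | 4 * lam <= `|ft j 0 - g j 0|].

Definition missed (X : R) :=
  [set j in S | (j \notin selected) && (X + 2 * lam < `|g j 0|)].

Lemma card_selected : (9 * T * #|selected| <= 10 * (T * nkeep D k))%N.
Proof.
have : (\sum_(j in selected) #|[set t | j \in Q t]| <= T * nkeep D k)%N.
  rewrite sum_card_exchange -[X in (_ <= X * _)%N](card_ord T) -sum_nat_const.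
  apply: leq_sum => t _; apply: leq_trans (subset_leq_card (subsetIl _ _)) _.
  by have [_ -> _] := QP t; apply: geq_minl.
rewrite -(leq_pmul2l (isT : 0 < 10)%N); apply: leq_trans.
rewrite big_distrr /= mulnC -sum_nat_const; apply: leq_sum => j.
by rewrite inE.
Qed.

(** A misjudged position was retained in at least 9 / 10 of the trials, and by [median_error] at
    least half of its estimates are wrong: 9 / 20 of the trials are charged for it. *)
Lemma card_misjudged : (9 * T * #|misjudged| <= 20 * \sum_t #|wrong t|)%N.
Proof.
have : (\sum_(j in misjudged) #|[set t | j \in wrong t]| <= \sum_t #|wrong t|)%N.
  rewrite sum_card_exchange; apply: leq_sum => t _.
  exact: subset_leq_card (subsetIl _ _).
rewrite -(leq_pmul2l (isT : 0 < 20)%N); apply: leq_trans.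
rewrite big_distrr /= mulnC -sum_nat_const; apply: leq_sum => j.
rewrite !inE => /andP[sel err]; have := ftP j; rewrite sel.
move=> /median_error /(_ err); rewrite size_map count_map.
rewrite size_filter count_filter !count_enum.
have le : (#|[set t | (4 * lam <= `|v t j - g j 0|)%R && (j \in Q t)]| <=
        #|[set t | j \in wrong t]|)%N.
  apply/subset_leq_card/subsetP => t; rewrite !inE => /andP[-> jQ].
  have [QE _ _] := QP t; rewrite andbT; have := subsetP QE _ jQ.
  by rewrite inE.
move: sel le; move: #|_| #|_| #|_| => x y z; lia.
Qed.

(** A position that is not selected was dropped in more than a tenth of the trials, and
    [card_unretained] bounds the drops of each trial. *)
Lemma card_missed p X : 0 <= X -> (#|S| <= nkeep D k + p)%N ->
    (forall j, j \notin S -> `|g j 0| <= X) ->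
  (T * #|missed X| <=
     10 * (T * p + (\sum_t #|bad_buckets t| + \sum_t #|bad_spikes t|)))%N.
Proof.
move=> X0 Sp SX.
have : (\sum_(j in missed X)
          #|[set t | j \in [set j in S | (X + 2 * lam < `|g j 0|)%R && (j \notin Q t)]]| <=
        T * p + (\sum_t #|bad_buckets t| + \sum_t #|bad_spikes t|))%N.
  rewrite sum_card_exchange -big_split /= -[X in (X * p)%N](card_ord T).
  rewrite -sum_nat_const -big_split /=; apply: leq_sum => t _.
  rewrite addnA; apply: leq_trans (card_unretained t X0 Sp SX).
  exact: subset_leq_card (subsetIl _ _).
rewrite -(leq_pmul2l (isT : 0 < 10)%N); apply: leq_trans.
rewrite big_distrr /= mulnC -sum_nat_const; apply: leq_sum => j.
rewrite !inE => /and3P[jS jQ jX].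
have -> : [set t | j \in [set j in S | (X + 2 * lam < `|g j 0|)%R && (j \notin Q t)]]
          = ~: [set t | j \in Q t].
  by apply/setP => t; rewrite !inE jS jX.
have := cardsC [set t | j \in Q t]; rewrite card_ord; move: jQ.
move: #|_| #|_| => x y; lia.
Qed.

(** All trials form one family of cells, so that convexity is used once and yields a single set J
    for all trials; a separate J for each trial would ruin the union bound. *)
Definition cell (x : 'I_T * 'I_(npart D k)) : {set 'I_(dim D)} :=
  bucket w (b := mkblock x.1) x.2.

Lemma excess_weight :
  excess cell weight =
  \sum_(t : 'I_T) \sum_(n : 'I_(npart D k)) Num.max 0 (mass (b := mkblock t) n - 1).
Proof. by rewrite pair_bigA. Qed.

(** A bad bucket has excess at least 1 / 2. *)
Lemma sum_bad_buckets : (\sum_t #|bad_buckets t|)%:R <= 2 * excess cell weight.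
Proof.
rewrite excess_weight natr_sum mulr_sumr; apply: ler_sum => t _.
rewrite -sum1_card natr_sum mulr_sumr big_mkcond /=; apply: ler_sum => n _.
rewrite inE /bad; set a := mass (b := mkblock t) n.
case: (leP (3 / 2) a) => h; rewrite maxEle; case: ifP => ?; lra.
Qed.

(** A bucket has at most as many spikes as its mass a, and a <= 3 (a - 1) when a >= 3 / 2. *)
Lemma sum_bad_spikes : (\sum_t #|bad_spikes t|)%:R <= 3 * excess cell weight.
Proof.
rewrite excess_weight natr_sum mulr_sumr; apply: ler_sum => t _.
apply: (@le_trans _ _ (\sum_(n | bad (b := mkblock t) n) mass (b := mkblock t) n)).
  rewrite /mass /bucket -sum1_card natr_sum.
  rewrite (partition_big (w (mkblock t)) (fun n => bad (b := mkblock t) n)) /=; last first.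
    by move=> j; rewrite inE => /andP[].
  apply: ler_sum => n _; rewrite big_mkcond [leRHS]big_mkcond /=.
  apply: ler_sum => j _; rewrite !inE; have /andP[w0 w1] := weight01 j.
  case: ifP => [/andP[/andP[/eqP -> _] ->] //|_].
  by case: ifP.
rewrite mulr_sumr big_mkcond /=; apply: ler_sum => n _.
rewrite /bad; set a := mass (b := mkblock t) n.
case: (leP (3 / 2) a) => h; rewrite maxEle; case: ifP => ?; lra.
Qed.

(* The new head consists of the missed large spikes and of the selected
   positions whose estimate is wrong. *)
Lemma pass_progress (p : nat) (X W Ex : R) : (0 < T)%N -> 0 <= X ->
    (#|S| <= nkeep D k + p)%N -> (#|S| <= 2 * nkeep D k)%N ->
    (forall j, j \notin S -> `|g j 0| <= X) ->
    \sum_(j | j \notin S) `|g j 0| <= W ->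
    excess cell weight <= Ex * T%:R ->
  exists S' : {set 'I_(dim D)},
  [/\ #|S'|%:R <= 10 * p%:R + 62 * Ex,
      forall j, j \notin S' -> `|g j 0 - ft j 0| <= X + 4 * lam &
      \sum_(j | j \notin S') `|g j 0 - ft j 0| <=
        W + (nkeep D k)%:R * (2 * X + 12 * lam)].
Proof.
move=> T0 X0 Sp S2 SX SW exW; have T0' : 0 < (T%:R : R) by rewrite ltr0n.
have bE := sum_bad_buckets; have sE := sum_bad_spikes.
pose F := (\sum_t #|bad_buckets t| + \sum_t #|bad_spikes t|)%N.
have FE : (F%:R : R) <= 5 * (Ex * T%:R) by rewrite natrD; lra.
have wF : (\sum_t #|wrong t| <= F)%N.
  by rewrite /F -big_split /=; apply: leq_sum => t _; apply: card_wrong.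
exists (missed X :|: misjudged).
have out j : j \notin missed X :|: misjudged ->
  `|g j 0 - ft j 0| <= if j \in selected then 4 * lam else
      if j \in S then X + 2 * lam else `|g j 0|.
  rewrite in_setU negb_or => /andP[jm]; rewrite [j \in misjudged]inE.
  case: ifP => [_ /=|]; first by rewrite -ltNge distrC => /ltW.
  rewrite [j \in selected]inE => nsel _; have := ftP j; rewrite nsel => ->; rewrite subr0.
  by move: jm; rewrite inE [j \in selected]inE nsel; case: ifP => //= _; rewrite -leNgt.
split.
(* The failures [F] are at most (2 + 3) Ex T. Missed spikes cost 10 F and misjudged positions 20 F /
   9, hence 50 Ex + 100 Ex / 9 <= 62 Ex. *)
- have c1 : (T * #|missed X| <= 10 * (T * p + F))%N by exact: card_missed.
  have c2 : (9 * T * #|misjudged| <= 20 * F)%N.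
    by apply: leq_trans card_misjudged _; rewrite leq_pmul2l.
  have c3 : (T * #|missed X :|: misjudged| <= T * #|missed X| + T * #|misjudged|)%N.
    by rewrite -mulnDr leq_mul2l leq_card_setU orbT.
  have FE0 : 0 <= Ex * T%:R by have := ler0n R F; lra.
  rewrite -(ler_pM2l T0'); move: c1 c2 c3.
  rewrite -!(ler_nat R) -mulnA !(natrM, natrD); lra.
- move=> j /out; have := lam_gt0; case: ifP => _; first lra.
  by case: ifPn => [_|/SX]; lra.
(* At most [2 * nkeep D k] positions are selected and as many lie in [S]. They contribute 4 lam and
   X + 2 lam each, together [nkeep D k] times 2 X + 12 lam; everything else is old noise. *)
apply: (@le_trans _ _ (\sum_j ((j \in selected)%:R * (4 * lam) +
   (j \in S)%:R * (X + 2 * lam) + (j \notin S)%:R * `|g j 0|))).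
  rewrite big_mkcond; apply: ler_sum => j _.
  case: ifP => [/out h|_]; last first.
    by rewrite !addr_ge0 ?mulr_ge0 ?ler0n //; have := lam_gt0; lra.
  apply: le_trans h _; have := lam_gt0; have := normr_ge0 (g j 0).
  by do 2 case: (_ \in _) => /=; lra.
rewrite !big_split -!mulr_suml /= -!natr_sum -!big_mkcond /= !sum1_card.
have -> : \sum_j ((j \notin S)%:R * `|g j 0|) = \sum_(j | j \notin S) `|g j 0|.
  rewrite [RHS]big_mkcond; apply: eq_bigr => j _.
  by case: ifP; rewrite ?mul1r ?mul0r.
have sel : (#|selected| <= 2 * nkeep D k)%N.
  by have := card_selected; move: #|_| => s; nia.
move: sel S2; rewrite -!(ler_nat R) !natrM; have := lam_gt0.
move: #|_|%:R #|_|%:R (nkeep D k)%:R => a b n; nra.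
Qed.
End Pass.

(** * Collisions of random partitions *)

Section Collisions.
Variables (D : design) (k : 'I_(npass D)).
Notation d := (dim D).
Notation T := (ntrial D k).
Notation r := (npart D k).
Implicit Types (w : sample D) (J : {set 'I_d}) (A : {set 'I_T * 'I_d}).

(** The smallest element of J in a bucket is not counted. A bucket with n > 0 elements of J thus
    contributes n - 1, its excess. *)
Definition collided w J (t : 'I_T) : {set 'I_d} :=
  [set j in J | [exists i in J, (i < j)%N && (w (mkblock t) i == w (mkblock t) j)]].

(** Resampling one column of one block: independence is used through injections between sets of
    samples instead of conditional probabilities. *)
Definition reassign w (t : 'I_T) (j : 'I_d) (x : 'I_r) : sample D :=
  finfun (dfwith w (i := mkblock t)
            [ffun i => if i == j then x else w (mkblock t) i]).

Lemma reassign_same w t j x i :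
  reassign w t j x (mkblock t) i = if i == j then x else w (mkblock t) i.
Proof. by rewrite ffunE dfwith_in ffunE. Qed.

Lemma reassign_other w t j x b : b != mkblock t -> reassign w t j x b = w b.
Proof. by move=> bt; rewrite ffunE dfwith_out // eq_sym. Qed.

Lemma mkblock_inj : injective (@mkblock D k).
Proof. by move=> t t' /eqP; rewrite /mkblock -tag_eqE /tag_eq eqxx /= tagged_asE => /eqP. Qed.

Definition all_collided A J : {set sample D} :=
  [set w | [forall p in A, p.2 \in collided w J p.1]].

(** Send (x, w) to a witness i < j of the collision of j in trial t, together with w whose column j
    in that trial is overwritten by x. Since j is maximal, the other collisions of A involve only
    smaller columns of trial t and survive. The map is injective: x can be read off, and the
    overwritten row is the row of the witness, which is untouched. *)
Lemma card_all_collided_step A J t j : (t, j) \in A ->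
    (forall p, p \in A -> (p.2 <= j)%N) ->
  (#|all_collided A J| * r <= #|J| * #|all_collided (A :\ (t, j)) J|)%N.
Proof.
move=> tjA maxj; rewrite -[X in (_ * X)%N](card_ord r) -[#|'I_r|]cardsT mulnC.
rewrite -!cardsX.
pose wit w := odflt j [pick i in J | (i < j)%N && (w (mkblock t) i == w (mkblock t) j)].
have witP w : w \in all_collided A J ->
  [/\ wit w \in J, (wit w < j)%N & w (mkblock t) (wit w) = w (mkblock t) j].
  rewrite inE => /forall_inP /(_ _ tjA) /=; rewrite inE => /andP[_ /exists_inP[i iJ iP]].
  rewrite /wit; case: pickP => [i' /= /and3P[? ? /eqP ?]//|/(_ i)] /=.
  by rewrite iJ iP.
pose phi (p : 'I_r * sample D) := (wit p.2, reassign p.2 t j p.1).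
rewrite -(card_in_imset (f := phi)).
  apply/subset_leq_card/subsetP => _ /imsetP[[x w] /setXP[_ /= wE] ->].
  have [wJ _ _] := witP _ wE; rewrite in_setX wJ /= inE.
  apply/forall_inP => p /setD1P[ptj pA].
  have := wE; rewrite inE => /forall_inP /(_ _ pA).
  rewrite !inE => /andP[-> /exists_inP[i iJ /andP[ip wi]]] /=.
  apply/exists_inP; exists i; rewrite // ip /=.
  have [pt|pt] := eqVneq p.1 t; last by rewrite !reassign_other // (inj_eq mkblock_inj).
  have pj : p.2 != j by apply: contra ptj => /eqP <-; rewrite -pt -surjective_pairing.
  have lt : (p.2 < j)%N by rewrite ltn_neqAle pj maxj.
  have ij : (i == j) = false by rewrite -val_eqE /= ltn_eqF // (ltn_trans ip).
  by rewrite pt !reassign_same (negbTE pj) ij -pt.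
move=> [x w] [x' w'] /setXP[_ /= wE] /setXP[_ /= wE'] [eq_wit eq_w].
have agree b i : (b, i) != (mkblock t, j) -> w b i = w' b i.
  move=> bi; have /(congr1 (fun w : sample D => w b i)) := eq_w.
  have [bt|bt] := eqVneq b (mkblock t); last by rewrite !reassign_other.
  by move: bi; rewrite bt xpair_eqE eqxx /= => /negbTE ij; rewrite !reassign_same ij.
have [_ lt1 e1] := witP _ wE; have [_ _ e2] := witP _ wE'.
congr pair.
  by have /(congr1 (fun w : sample D => w (mkblock t) j)) := eq_w; rewrite !reassign_same eqxx.
apply/ffunP => b; apply/ffunP => i.
have [[-> ->]|/eqP ne] := (b, i) =P (mkblock t, j); last exact: agree.
rewrite -e1 -e2 eq_wit agree // xpair_eqE eqxx /= -eq_wit -val_eqE /=.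
by rewrite ltn_eqF.
Qed.

(* Exposing the columns in increasing order, each one hits a bucket that is
   already occupied with conditional probability at most [#|J| / r]. *)
Lemma card_all_collided A J :
  (#|all_collided A J| * r ^ #|A| <= #|J| ^ #|A| * #|sample D|)%N.
Proof.
have [n] := ubnP #|A|; elim: n A => // n IHn A; rewrite ltnS => An.
have [->|[p0 p0A]] := set_0Vmem A.
  by rewrite cards0 !expn0 muln1 mul1n max_card.
have [[t j] tjA max] : exists2 p, p \in A & forall p', p' \in A -> (p'.2 <= p.2)%N.
  case: (arg_maxnP (fun p : 'I_T * 'I_d => p.2 : nat) p0A) => p pA pmax.
  by exists p.
rewrite (cardsD1 (t, j)) tjA add1n !expnS.
have := card_all_collided_step J tjA max.
have /IHn : (#|A :\ (t, j)| < n)%N by rewrite (cardsD1 (t, j)) tjA in An.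
move: #|all_collided _ _| #|all_collided _ _| (r ^ _)%N (#|J| ^ _)%N #|sample D| => a b c e f.
by move=> h1 h2; nia.
Qed.

Definition crowded (N q : nat) : {set sample D} :=
  [set w | [exists J : {set 'I_d},
     (#|J| <= N)%N && (q <= \sum_(t : 'I_T) #|collided w J t|)%N]].

(** A nonempty set of at most N elements is the image of a map from ['I_N]. The empty set, which has
    no collisions, is left out to keep the bound a pure power. *)
Lemma card_small_sets (I : finType) N :
  (#|[set J : {set I} | (0 < #|J| <= N)%N]| <= #|I| ^ N)%N.
Proof.
rewrite -[N in (_ ^ N)%N]card_ord -card_ffun.
pose im (h : {ffun 'I_N -> I}) := [set h i | i : 'I_N].
apply: leq_trans (_ : #|im @: setT| <= _)%N; last first.
  by rewrite -cardsT leq_imset_card.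
apply/subset_leq_card/subsetP => J; rewrite inE => /andP[/card_gt0P[i0 i0J] JN].
(* Indices past the end of the enumeration repeat the element [i0]. *)
apply/imsetP; exists [ffun i : 'I_N => nth i0 (enum J) i] => //.
apply/setP => j; apply/idP/imsetP => [jJ|[i _ ->]].
  have jN : (index j (enum J) < N)%N.
    by apply: leq_trans JN; rewrite cardE index_mem mem_enum.
  by exists (Ordinal jN) => //; rewrite ffunE nth_index ?mem_enum.
rewrite ffunE; have [iJ|iJ] := ltnP i (size (enum J)).
  by rewrite -mem_enum mem_nth.
by rewrite nth_default.
Qed.

Lemma card_bigcup_le (I X : finType) (P : {set I}) (F : I -> {set X}) :
  (#|\bigcup_(i in P) F i| <= \sum_(i in P) #|F i|)%N.
Proof.
elim/big_rec2: _ => [|i A n _ IH]; first by rewrite cards0.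
by apply: leq_trans (leq_card_setU _ _) _; rewrite leq_add2l.
Qed.

(** Union bound over J and over q-element sets A of pairs (trial, element of J): d^N choices of J,
    at most C(T N, q) of A, each with probability at most (N / r)^q. As q > 0, a crowded J is
    nonempty. *)
Lemma card_crowded N q : (0 < q)%N ->
  (#|crowded N q| * r ^ q <= d ^ N * 'C(T * N, q) * N ^ q * #|sample D|)%N.
Proof.
move=> q0.
pose JJ := [set J : {set 'I_d} | (0 < #|J| <= N)%N].
pose AA J := [set A : {set 'I_T * 'I_d} | A \subset setX setT J & #|A| == q].
have sub : crowded N q \subset \bigcup_(J in JJ) \bigcup_(A in AA J) all_collided A J.
  apply/subsetP => w; rewrite inE => /existsP[J /andP[JN qJ]].
  pose B := [set p : 'I_T * 'I_d | p.2 \in collided w J p.1].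
  have BE : #|B| = (\sum_(t : 'I_T) #|collided w J t|)%N.
    rewrite -sum1_card (eq_bigr (fun t => \sum_(j in collided w J t) 1)%N); last first.
      by move=> t _; rewrite sum1_card.
    by rewrite pair_big_dep /=; apply: eq_bigl => p; rewrite inE.
  have [A AB Aq] : exists2 A : {set 'I_T * 'I_d}, A \subset B & #|A| == q.
    rewrite -BE in qJ; exists [set x in take q (enum B)].
      by apply/subsetP => p; rewrite inE => /mem_take; rewrite mem_enum.
    by rewrite cardsE (card_uniqP _) ?take_uniq ?enum_uniq // size_takel -?cardE.
  have AJ : A \subset setX setT J.
    apply/subsetP => p /(subsetP AB); rewrite !inE => /andP[-> _] //.
  apply/bigcupP; exists J; last apply/bigcupP.
    rewrite inE JN andbT card_gt0; apply: contraTneq Aq => J0.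
    have -> : A = set0.
      by apply/setP => p; rewrite inE; apply/negP => /(subsetP AJ); rewrite J0 !inE.
    by rewrite cards0 neq_ltn q0.
  exists A; first by rewrite inE AJ.
  by rewrite inE; apply/forall_inP => p /(subsetP AB); rewrite inE.
apply: leq_trans (leq_mul (subset_leq_card sub) (leqnn _)) _.
apply: leq_trans (leq_mul (card_bigcup_le _ _) (leqnn _)) _.
apply: (@leq_trans (\sum_(J in JJ) 'C(T * N, q) * N ^ q * #|sample D|)%N).
  rewrite big_distrl /=; apply: leq_sum => J; rewrite inE => /andP[_ JN].
  apply: leq_trans (leq_mul (card_bigcup_le _ _) (leqnn _)) _.
  rewrite big_distrl /=.
  apply: (@leq_trans (\sum_(A in AA J) N ^ q * #|sample D|)%N).
    apply: leq_sum => A; rewrite inE => /andP[_ /eqP Aq].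
    rewrite -[in X in (X <= _)%N]Aq; apply: leq_trans (card_all_collided A J) _.
    by rewrite Aq leq_mul2r leq_exp2r ?JN ?orbT.
  rewrite sum_nat_const cards_draws cardsX cardsT card_ord mulnA !leq_mul2r.
  by rewrite leq_bin2l ?orbT // leq_mul2l JN orbT.
rewrite sum_nat_const -!mulnA leq_mul2r; apply/orP; right.
by apply: leq_trans (card_small_sets _ _) _; rewrite card_ord.
Qed.
End Collisions.

(** * From bucket weights to collisions, and the probability of crowding *)

Section Spread.
Variables (R : realType) (D : design) (k : 'I_(npass D)) (w : sample D).

Lemma excess_indicator (J : {set 'I_(dim D)}) :
  excess (cell w (k := k)) (fun j => (j \in J)%:R) <=
  (\sum_(t : 'I_(ntrial D k)) #|collided w J t|)%:R :> R.
Proof.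
rewrite /excess natr_sum.
rewrite (eq_bigr (fun t => \sum_(n : 'I_(npart D k))
  \sum_(j in cell w (t, n)) ((j \in collided w J t)%:R : R))); last first.
  move=> t _; rewrite -sum1_card natr_sum big_mkcond /=.
  rewrite (partition_big (w (mkblock t)) xpredT) //=; apply: eq_bigr => n _.
  by apply: eq_big => [j|j _]; [rewrite !inE|case: (j \in _)].
rewrite pair_bigA /=; apply: ler_sum => -[t n] _ /=.
rewrite ge_max sumr_ge0 //=.
set C := cell w (t, n).
have [/eqP|[j0 j0C]] := set_0Vmem (C :&: J).
  rewrite setI_eq0 => /disjointFr CJ; rewrite big1 ?sumr_ge0 ?subr_le0 //.
    by rewrite lerBlDr addr_ge0 // sumr_ge0.
  by move=> j /CJ ->.
(* The smallest element of J in the cell absorbs the -1 of the excess; every other one collides with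
   it. *)
case: (arg_minnP (fun j : 'I_(dim D) => j : nat) j0C) => m /setIP[mC mJ] min.
rewrite (bigD1 m) //= mJ addrAC subrr add0r [leRHS](bigD1 m) //= ler_wpDl //.
apply: ler_sum => j /andP[jC jm]; rewrite ler_nat.
case jJ : (j \in J) => //; rewrite inE jJ lt0b /=.
apply/exists_inP; exists m => //.
have -> : (m < j)%N.
  have mj : (m <= j)%N by apply: min; apply/setIP.
  by rewrite ltn_neqAle mj andbT eq_sym.
by move: mC jC; rewrite !inE /= => /eqP -> /eqP ->.
Qed.

Lemma uncrowded_excess (N q : nat) (u : 'I_(dim D) -> R) :
    w \notin crowded k N q -> (forall j, 0 <= u j <= 1) -> \sum_j u j <= N%:R ->
  excess (cell w (k := k)) u <= q%:R.
Proof.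
move=> nc u01 uN; apply: (excess_le_vertices _ u01 uN) => J JN.
apply: le_trans (excess_indicator J) _; rewrite ler_nat.
move: nc; rewrite inE negb_exists => /forallP /(_ J).
by rewrite JN /= -ltnNge => /ltnW.
Qed.

(** The left side is one term of the expansion of (1 + y)^n, and 1 + y <= e^y. *)
Lemma bin_expR (n q : nat) (y : R) : 0 <= y ->
  'C(n, q)%:R * y ^+ q <= expR (n%:R * y).
Proof.
move=> y0; have [nq|qn] := ltnP n q.
  by rewrite bin_small // mul0r expR_ge0.
apply: (@le_trans _ _ ((1 + y) ^+ n)).
  rewrite exprDn (bigD1 (inord q)) //= inordK // expr1n mul1r mulr_natl lerDl.
  by apply: sumr_ge0 => i _; rewrite mulrn_wge0 // expr1n mul1r exprn_ge0.
rewrite expRM_natl lerXn2r ?nnegrE ?expR_ge0 ?expR_ge1Dx //; lra.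
Qed.

(** A bound of Chernoff type with free parameter [s]: the factor C(T N, q) (N / r)^q equals s^(-q)
    C(T N, q) y^q for y = s N / r. *)
Lemma prob_crowded (N q : nat) (s : R) : (0 < q)%N -> (0 < npart D k)%N -> 0 < s ->
  #|crowded k N q|%:R / #|sample D|%:R <=
  (dim D)%:R ^+ N *
  expR ((ntrial D k * N)%:R * (s * N%:R / (npart D k)%:R)) / s ^+ q.
Proof.
move=> q0 r0 s0; have r0' : 0 < ((npart D k)%:R : R) by rewrite ltr0n.
have [->|O0] := posnP #|sample D|.
  by rewrite invr0 mulr0 !mulr_ge0 ?exprn_ge0 ?expR_ge0 ?invr_ge0 // exprn_ge0 // ltW.
rewrite ler_pdivrMr ?ltr0n // mulrAC ler_pdivlMr ?exprn_gt0 //.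
rewrite -(ler_pM2r (exprn_gt0 q r0')) mulrAC.
have := card_crowded k N q0; rewrite -(ler_nat R) !natrM !natrX => h.
apply: le_trans (ler_wpM2r _ h) _; first by rewrite exprn_ge0 // ltW.
have y0 : 0 <= s * N%:R / (npart D k)%:R by rewrite divr_ge0 ?mulr_ge0 // ltW.
have := ler_wpM2r (ltW (exprn_gt0 q r0')) (bin_expR (ntrial D k * N) q y0).
rewrite -[X in X <= _ -> _]mulrA -exprMn divfK ?gt_eqF // exprMn natrM.
move: (expR _) => e b.
have P0 : 0 <= (dim D)%:R ^+ N * #|sample D|%:R :> R by rewrite mulr_ge0 ?exprn_ge0.
have := ler_wpM2l P0 b; congr (_ <= _); ring.
Qed.
End Spread.

(** * Accuracy of the recovery *)

Section RealFacts.
Variable R : realType.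

Lemma truncn_gt (x : R) : x < (Num.truncn x)%:R + 1.
Proof. by rewrite natr1 truncnS_gt. Qed.

Lemma natrS_sub1 (n : nat) : n%:R = n.+1%:R - 1 :> R.
Proof. by rewrite -natr1 addrK. Qed.

Lemma ltnS_natr (a b : nat) : a%:R < b%:R + 1 :> R -> (a <= b)%N.
Proof. by rewrite natr1 ltr_nat. Qed.

Lemma ln8_ge1 : 1 <= ln (8 : R).
Proof.
have e2 : expR 1 <= 8 :> R.
  have := expR_ge1Dx (- (1 / 2) : R); rewrite expRN => h.
  have e0 := expR_gt0 (1 / 2 : R).
  have h1 : expR (1 / 2) <= 2 :> R.
    by rewrite -[leRHS]invrK -[leLHS]invrK lef_pV2 ?posrE ?invr_gt0 //; lra.
  have -> : 1 = 1 / 2 + 1 / 2 :> R by lra.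
  by rewrite expRD; nra.
by rewrite -[leLHS]expRK ler_ln ?posrE ?expR_gt0.
Qed.

(** An absolute lower bound on ln d, with which additive constants, such as those from ceilings, are
    absorbed into multiples of ln d. *)
Lemma ln_ge_third (n : nat) : (2 <= n)%N -> 1 / 3 <= ln (n%:R : R).
Proof.
move=> n2.
have : ln (8 : R) = 3 * ln 2 by rewrite mulr_natl -lnXn // -natrX.
have : ln 2 <= ln (n%:R : R) by rewrite ler_ln ?posrE ?ltr0n ?ler_nat // ltnW.
have := ln8_ge1; lra.
Qed.

Lemma absz_ceil (x : R) : 0 <= x -> x <= (`|Num.ceil x|%N)%:R < x + 1.
Proof.
move=> x0; have c0 : 0 <= Num.ceil x by rewrite ceil_ge0; lra.
have := ceil_itv x; rewrite -{2 4}(gez0_abs c0) intrD /= => /andP[h1 h2].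
by apply/andP; split=> //; move: h1; rewrite -{1}(gez0_abs c0) -pmulrn; lra.
Qed.

(** The ratio 4^k between [m / 2 ^ k] and [m / 8 ^ k] pays for the factor (k + 1)^2 in the square of
    [crowd_size]. *)
Lemma sqr_le_4exp k : k.+1%:R ^+ 2 <= 4 ^+ k :> R.
Proof.
have h : (k.+1 <= 2 ^ k)%N by apply: ltn_expl.
by rewrite -(natrX R 4) -natrX ler_nat -[4%N]/(2 ^ 2)%N -expnM mulnC expnM leq_exp2r.
Qed.

End RealFacts.

(** * Errors of best approximations *)

Section BestApprox.
Variables (R : realType) (d m : nat).

(** The differences of the two sets have equal size, and every element of one beats every element of
    the other; summing over all pairs compares the two sums. *)
Lemma largest_sum (n : nat) (v : 'I_d -> R) (Q Q' : {set 'I_d}) :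
    largest n setT v Q -> #|Q'| = #|Q| ->
  \sum_(j | j \notin Q) `|v j| <= \sum_(j | j \notin Q') `|v j|.
Proof.
move=> [_ _ top] cQ.
have split_off (A B : {set 'I_d}) : \sum_(j | j \notin A) `|v j| =
    \sum_(j in B :\: A) `|v j| + \sum_(j in ~: (A :|: B)) `|v j|.
  rewrite (bigID (mem B)) /=; congr (_ + _); apply: eq_bigl => j.
    by rewrite !inE.
  by rewrite !inE negb_or.
rewrite (split_off Q Q') (split_off Q' Q) [Q' :|: Q]setUC lerD2r.
have cD : #|Q' :\: Q| = #|Q :\: Q'|.
  apply/eqP; rewrite -(eqn_add2l #|Q :&: Q'|) cardsID setIC cardsID.
  exact/eqP.
have [c0|c0] := posnP #|Q' :\: Q|.
  move: cD; rewrite c0 => /esym/eqP; move/eqP: c0.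
  by rewrite !cards_eq0 => /eqP -> /eqP ->.
have : \sum_(i in Q :\: Q') \sum_(j in Q' :\: Q) `|v j| <=
       \sum_(i in Q :\: Q') \sum_(j in Q' :\: Q) `|v i|.
  apply: ler_sum => i /setDP[iQ _]; apply: ler_sum => j jQ.
  by apply: top => //; case/setDP: jQ => _ jQ; rewrite !inE jQ.
rewrite exchange_big /=; under eq_bigr do rewrite sumr_const.
under [leRHS]eq_bigr do rewrite sumr_const.
by rewrite !sumrMnl cD ler_pMn2r // -cD.
Qed.

Lemma l1norm_ge0 (f : 'cV[R]_d) : 0 <= l1norm f.
Proof. exact: sumr_ge0. Qed.

Lemma l1normD (f g : 'cV[R]_d) : l1norm (f + g) <= l1norm f + l1norm g.
Proof.
by rewrite /l1norm -big_split; apply: ler_sum => j _; rewrite mxE ler_normD.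
Qed.

Lemma l1norm_eq0 (f : 'cV[R]_d) : l1norm f <= 0 -> f = 0.
Proof.
move=> f0; apply/colP => j; rewrite mxE; apply/eqP.
rewrite -normr_le0; apply: le_trans f0; rewrite /l1norm (bigD1 j) //= lerDl.
exact: sumr_ge0.
Qed.

Lemma best_approx_tail (f g : 'cV[R]_d) : best_approx m f g ->
  exists2 Q : {set 'I_d}, largest m setT (fun j => f j 0) Q &
    l1norm (f - g) = \sum_(j | j \notin Q) `|f j 0|.
Proof.
move=> [Q QL gE]; exists Q => //; rewrite [RHS]big_mkcond; apply: eq_bigr => j _.
by rewrite !mxE gE; case: (j \in Q); rewrite ?subrr ?normr0 ?subr0.
Qed.

(** Cutting [h] down to its own largest entries loses no more than cutting it down to the head of
    [f], which loses at most the tail of [f] plus the distance from [f] to [h]. *)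
Lemma best_approx_near (f fm h fhat : 'cV[R]_d) :
    best_approx m f fm -> best_approx m h fhat ->
  l1norm (f - fhat) <= 2 * l1norm (f - h) + l1norm (f - fm).
Proof.
move=> /best_approx_tail[Q QL fE] /best_approx_tail[Q' QL' hE].
have hf : l1norm (h - fhat) <= l1norm (f - h) + l1norm (f - fm).
  have cQ : #|Q| = #|Q'| by case: QL => _ -> _; case: QL'.
  rewrite hE fE; apply: le_trans (largest_sum QL' cQ) _.
  rewrite big_mkcond [X in _ + X]big_mkcond -big_split; apply: ler_sum => j _ /=.
  rewrite !mxE; case: ifP => _; last by rewrite addr0.
  have := ler_normD (h j 0 - f j 0) (f j 0); rewrite subrK distrC; lra.
have := l1normD (f - h) (h - fhat); rewrite addrA subrK; lra.
Qed.

Lemma nnz_best_approx (f g : 'cV[R]_d) : best_approx m f g -> (nnz g <= m)%N.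
Proof.
move=> [Q [_ cQ _] gE]; apply: (@leq_trans #|Q|); last by rewrite cQ geq_minl.
apply/subset_leq_card/subsetP => j; rewrite inE gE.
by case: ifP => //; rewrite eqxx.
Qed.

End BestApprox.

(** * The good event and the invariant of the loop, for a = 8 *)

Section Recovery.
Variables (R : realType) (c1 c2 : R) (d m : nat).
Hypotheses (d_ge2 : (2 <= d)%N) (m_ge1 : (1 <= m)%N) (c1_gt0 : 0 < c1) (c2_gt0 : 0 < c2).
Notation D := (chaining_design 8 c1 c2 d m).

(** The unrounded m_k: the invariant needs exact divisions by 8, while [nkeep] is its integer
    part. *)
Definition level (k : nat) : R := m%:R / 8 ^+ k.

Lemma level_gt0 k : 0 < level k.
Proof. by rewrite divr_gt0 ?exprn_gt0 ?ltr0n. Qed.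

Lemma levelS k : level k.+1 = level k / 8.
Proof. by rewrite /level exprS; field; rewrite expf_neq0 //= pnatr_eq0. Qed.

Lemma level_exp4 k : level k * 4 ^+ k = m%:R / 2 ^+ k.
Proof.
rewrite /level (_ : 8 = 2 * 4 :> R); last by lra.
by rewrite exprMn invfM -!mulrA mulVf ?mulr1 // expf_neq0 // pnatr_eq0.
Qed.

Lemma ln_m_ge0 : 0 <= ln (m%:R : R).
Proof. by rewrite ln_ge0 // ler1n. Qed.

Lemma level_ge1 k : (k < npass D)%N -> 1 <= level k.
Proof.
rewrite /= ltnS => kK.
have q0 : 0 <= ln (m%:R : R) / ln 8 by rewrite divr_ge0 ?ln_m_ge0 // (le_trans _ (ln8_ge1 R)).
have m0 : 0 < (m%:R : R) by rewrite ltr0n.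
have : k%:R <= ln (m%:R : R) / ln 8.
  by have /andP[h _] := truncn_itv q0; apply: le_trans h; rewrite ler_nat.
rewrite ler_pdivlMr ?(lt_le_trans ltr01 (ln8_ge1 R)) // mulr_natl -lnXn ?ltr0n //.
by rewrite ler_ln ?posrE ?exprn_gt0 // ler_pdivlMr ?mul1r ?exprn_gt0.
Qed.

Lemma level_npass_lt1 : level (npass D) < 1.
Proof.
have m0 : 0 < (m%:R : R) by rewrite ltr0n.
have := truncnS_gt (ln (m%:R : R) / ln 8).
rewrite ltr_pdivrMr ?(lt_le_trans ltr01 (ln8_ge1 R)) // mulr_natl -lnXn ?ltr0n //.
by rewrite ltr_ln ?posrE ?exprn_gt0 // ltr_pdivrMr ?mul1r ?exprn_gt0.
Qed.

Lemma npass_le : (npass D)%:R <= 1 + ln (m%:R : R).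
Proof.
have q0 : 0 <= ln (m%:R : R) / ln 8 by rewrite divr_ge0 ?ln_m_ge0 // (le_trans _ (ln8_ge1 R)).
rewrite /= -natr1 addrC lerD2l; have /andP[h _] := truncn_itv q0; apply: le_trans h _.
rewrite ler_pdivrMr ?(lt_le_trans ltr01 (ln8_ge1 R)) // ler_peMr ?ln_m_ge0 ?(ln8_ge1 R) //.
Qed.

Lemma ntrial_itv k :
  c1 * k.+1%:R * ln d%:R <= (ntrial D k)%:R < c1 * k.+1%:R * ln d%:R + 1.
Proof.
by apply: absz_ceil; rewrite !mulr_ge0 ?(ltW c1_gt0) //; have := ln_ge_third R d_ge2; lra.
Qed.

Lemma npart_itv k :
  c2 * m%:R / 2 ^+ k <= (npart D k)%:R < c2 * m%:R / 2 ^+ k + 1.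
Proof.
by apply: absz_ceil; rewrite !mulr_ge0 ?invr_ge0 ?exprn_ge0 ?(ltW c2_gt0).
Qed.

Lemma nkeep_itv k : (nkeep D k)%:R <= level k < (nkeep D k)%:R + 1.
Proof. by rewrite natr1; apply: truncn_itv; apply/ltW/level_gt0. Qed.

Lemma ntrial_gt0 k : (0 < ntrial D k)%N.
Proof.
rewrite -(ltr0n R); have /andP[h _] := ntrial_itv k; apply: lt_le_trans h.
by rewrite !mulr_gt0 ?ltr0n //; have := ln_ge_third R d_ge2; lra.
Qed.

Lemma npart_gt0 k : (0 < npart D k)%N.
Proof.
rewrite -(ltr0n R); have /andP[h _] := npart_itv k; apply: lt_le_trans h.
by rewrite !mulr_gt0 ?invr_gt0 ?exprn_gt0 ?ltr0n.
Qed.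

(** In pass k head and noise have total weight at most 652 (k + 1) [level k]; 700 leaves room for
    the rounding. *)
Definition crowd_size (k : nat) : nat := Num.truncn (700 * k.+1%:R * level k).
Definition crowd_bound (k : nat) : nat :=
  Num.truncn (level k * (ntrial D k)%:R / 2048).

Hypothesis c1_large : 4096 * 705 <= c1.
Hypothesis c2_large : 4096 * 700 ^+ 2 * expR 2 <= c2.

(** The hypothesis on [c1] provides twice the claimed bound, 4096 = 2 * 2048; the spare half exceeds
    the loss of at most 1 from truncation. *)
Lemma crowd_bound_ge k : (k < npass D)%N ->
  705 * k.+1%:R * level k * ln d%:R <= (crowd_bound k)%:R.
Proof.
move=> /level_ge1 nu1; have /andP[T1 _] := ntrial_itv k.
have k1 : 1 <= k.+1%:R :> R by rewrite ler1n.
have ld := ln_ge_third R d_ge2.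
have : level k * (ntrial D k)%:R / 2048 < (crowd_bound k)%:R + 1.
  by rewrite natr1 truncnS_gt.
have kd : 1 / 3 <= k.+1%:R * ln d%:R :> R by nra.
have P0 : 1 / 3 <= k.+1%:R * level k * ln d%:R by rewrite mulrAC; nra.
have : 4096 * 705 * (k.+1%:R * level k * ln d%:R) <= level k * (ntrial D k)%:R.
  have : 4096 * 705 * (k.+1%:R * ln d%:R) <= (ntrial D k)%:R :> R.
    apply: le_trans T1; rewrite -[leRHS]mulrA ler_wpM2r //; lra.
  move=> h; have := ler_wpM2l (ltW (level_gt0 k)) h; lra.
lra.
Qed.

Lemma crowd_bound_le k : (crowd_bound k)%:R <= level k / 2048 * (ntrial D k)%:R.
Proof.
have h : 0 <= level k * (ntrial D k)%:R / 2048.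
  by apply: divr_ge0 => //; apply: mulr_ge0 => //; apply/ltW/level_gt0.
by rewrite mulrAC; have /andP[] := truncn_itv h.
Qed.

(** [prob_crowded] is used with s = e^2. Its denominator gives e^(-2 q); one factor e^q goes to the
    inner exponential, and the other beats the d^N sets and leaves the stated probability. *)
Lemma prob_crowd (k : 'I_(npass D)) :
  #|crowded k (crowd_size k) (crowd_bound k)|%:R / #|sample D|%:R <=
  d%:R ^- 3 * 2 ^- k.+1 :> R.
Proof.
have nu1 := level_ge1 (ltn_ord k); set nu := level k in nu1 *.
have ld := ln_ge_third R d_ge2; set l := ln (d%:R : R) in ld *.
have k1 : 1 <= k.+1%:R :> R by rewrite ler1n.
have kl : 1 / 3 <= k.+1%:R * l by nra.
have P0 : 1 / 3 <= k.+1%:R * nu * l by rewrite mulrAC; nra.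
have qb := crowd_bound_ge (ltn_ord k); rewrite -/nu -/l in qb.
set q := crowd_bound k in qb *; set N := crowd_size k.
have q0 : (0 < q)%N by rewrite -(ltr0n R); lra.
have NN : N%:R <= 700 * k.+1%:R * nu.
  have h : 0 <= 700 * k.+1%:R * nu.
    apply: mulr_ge0; [exact: mulr_ge0|exact: le_trans ler01 nu1].
  by have /andP[] := truncn_itv h.
apply: le_trans (prob_crowded N q0 (npart_gt0 k) (expR_gt0 2)) _.
have d0 : 0 < (d%:R : R) by rewrite ltr0n ltnW.
have dE : d%:R = expR l by rewrite lnK // posrE.
rewrite [(dim D)%:R]dE.
rewrite -!expRM_natl -expRD -!expRN.
apply: (@le_trans _ _ (expR (- (3 * l)) * expR (- (k.+1%:R * l)))); last first.
  rewrite ler_pM2l ?expR_gt0 // expRN expRM_natl lef_pV2 ?posrE ?exprn_gt0 ?expR_gt0 //.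
  by rewrite lerXn2r ?nnegrE ?expR_ge0 // lnK ?posrE // ler_nat.
rewrite -!expRD ler_expR.
(* This is where [c2] is fixed: since q is at least T [level k] / 4096, it suffices that 4096 e^2
   N^2 is at most [level k] times r, where r >= c2 4^k [level k]. *)
have e1 : (ntrial D k * N)%:R * (expR 2 * N%:R / (npart D k)%:R) <= q%:R :> R.
  have N2 : N%:R ^+ 2 <= 700 ^+ 2 * k.+1%:R ^+ 2 * nu ^+ 2.
    by rewrite -!exprMn lerXn2r ?nnegrE // (le_trans _ NN).
  have /andP[rk _] := npart_itv k.
  have r0 : 0 < (npart D k)%:R :> R by rewrite ltr0n npart_gt0.
  have nu_def : nu * 4 ^+ k = m%:R / 2 ^+ k by exact: level_exp4.
  have rk' : 4096 * expR 2 * N%:R ^+ 2 <= nu * (npart D k)%:R.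
    have e0 := expR_gt0 (2 : R).
    apply: (@le_trans _ _ (4096 * expR 2 * (700 ^+ 2 * k.+1%:R ^+ 2 * nu ^+ 2))).
      by rewrite ler_wpM2l // mulr_ge0 // ltW.
    apply: (@le_trans _ _ (nu * (c2 * (nu * 4 ^+ k)))); last first.
      by rewrite nu_def ler_wpM2l ?(le_trans ler01) // mulrA.
    have k4 := sqr_le_4exp R k.
    have nu2 : 0 <= nu ^+ 2 by rewrite exprn_ge0 // (le_trans ler01).
    have c0 : 0 <= 4096 * 700 ^+ 2 * expR 2 :> R.
      by rewrite !mulr_ge0 ?exprn_ge0 ?expR_ge0.
    have := ler_wpM2l nu2 (ler_pM c0 (exprn_ge0 2 (ler0n R k.+1)) c2_large k4).
    by congr (_ <= _); ring.
  have qT : level k * (ntrial D k)%:R / 4096 <= q%:R.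
    have := truncn_gt (level k * (ntrial D k)%:R / 2048).
    have q1 : 1 <= q%:R :> R by rewrite ler1n.
    by rewrite -/(crowd_bound k) -/q; lra.
  apply: le_trans qT; rewrite natrM [leRHS]mulrAC.
  rewrite [leLHS](_ : _ = expR 2 * N%:R ^+ 2 / (npart D k)%:R * (ntrial D k)%:R); last by ring.
  rewrite ler_wpM2r // ler_pdivrMr // -/nu; lra.
have e2 : N%:R * l <= 700 * k.+1%:R * nu * l by rewrite ler_wpM2r //; lra.
have e3 : k.+1%:R * l <= k.+1%:R * nu * l by nra.
have e4 : l <= k.+1%:R * l by nra.
(* Of the 705 units, 700 pay for the choice of J, 3 for d^(-3) and 1 for 2^(-(k+1)); one is
   spare. *)
have e5 : q%:R >= 705 * (k.+1%:R * nu * l) by lra.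
lra.
Qed.

Definition spread (w : sample D) : bool :=
  [forall k : 'I_(npass D), w \notin crowded k (crowd_size k) (crowd_bound k)].

Lemma sample_gt0 : (0 < #|sample D|)%N.
Proof.
pose n0 (b : block D) : 'I_(npart D (tag b)) := Ordinal (npart_gt0 (tag b)).
by apply/card_gt0P; exists (finfun (fun b => [ffun=> n0 b])).
Qed.

Lemma prob_spread : 1 - 1 / d%:R ^+ 3 <= #|[set w | spread w]|%:R / #|sample D|%:R :> R.
Proof.
have O0 : 0 < #|sample D|%:R :> R by rewrite ltr0n sample_gt0.
have d0 : 0 < (d%:R : R) by rewrite ltr0n ltnW.
have -> : #|[set w | spread w]|%:R / #|sample D|%:R =
          1 - #|~: [set w | spread w]|%:R / #|sample D|%:R :> R.
  have := cardsC [set w | spread w]; move/(congr1 (fun n => n%:R : R)).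
  by rewrite natrD => E; rewrite -E; field; rewrite E gt_eqF.
rewrite lerD2l lerN2 mul1r.
have sub : ~: [set w | spread w] \subset
    \bigcup_(k in [set: 'I_(npass D)]) crowded k (crowd_size k) (crowd_bound k).
  apply/subsetP => w; rewrite !inE negb_forall => /existsP[k].
  by rewrite negbK => kw; apply/bigcupP; exists k.
apply: (@le_trans _ _ (\sum_(k < npass D) d%:R ^- 3 * 2 ^- k.+1)).
  apply: (@le_trans _ _ (\sum_(k < npass D)
    #|crowded k (crowd_size k) (crowd_bound k)|%:R / #|sample D|%:R)).
    rewrite -mulr_suml ler_pM2r ?invr_gt0 // -natr_sum ler_nat.
    apply: leq_trans (subset_leq_card sub) _; apply: leq_trans (card_bigcup_le _ _) _.
    by rewrite big_mkcond /=; apply: leq_sum => k _; rewrite inE.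
  by apply: ler_sum => k _; apply: prob_crowd.
rewrite -mulr_sumr ger_pMr ?invr_gt0 ?exprn_gt0 //.
suff -> n : \sum_(k < n) 2 ^- k.+1 = 1 - 2 ^- n :> R.
  by rewrite gerBl invr_ge0 exprn_ge0.
elim: n => [|n IHn]; first by rewrite big_ord0 expr0 invr1 subrr.
by rewrite big_ord_recr IHn /= exprS; field; rewrite expf_neq0 //= pnatr_eq0.
Qed.

Lemma uniform_prob_spread (E : sample D -> Prop) : (forall w, spread w -> E w) ->
  1 - 1 / d%:R ^+ 3 <= uniform_prob R E.
Proof.
move=> sE; apply: le_trans prob_spread _.
rewrite ler_pM2r ?invr_gt0 ?ltr0n ?sample_gt0 // ler_nat.
by apply/subset_leq_card/subsetP => w; rewrite !inE => /sE /asboolP.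
Qed.

(* The invariant of the loop, where [s] is any number above [l1norm (f - fm)].
   The bound off the head is used with [lam = s / level k] and [X = 320 * lam] in
   [pass_progress]: each pass adds [nkeep D k * (2 * X + 12 * lam) <= 652 * s] to
   the noise.  Summed over the passes, this is the factor [1 + ln m]. *)
Definition residual_bound (s : R) (k : nat) (g : 'cV[R]_d) : Prop :=
  exists S : {set 'I_d},
  [/\ #|S|%:R <= (nkeep D k)%:R + level k / 320,
      forall j, j \notin S -> `|g j 0| <= 320 * (s / level k) &
      \sum_(j | j \notin S) `|g j 0| <= (1 + 652 * k%:R) * s].

Lemma residual_bound_pass (s : R) (w : sample D) (k : 'I_(npass D)) (g ft : 'cV[R]_d) :
    0 < s -> spread w -> residual_bound s k g -> pass k (Phi R w *m g) ft ->
  residual_bound s k.+1 (g - ft).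
Proof.
move=> s0 /forallP /(_ k) wk [S [Sn Sinf S1]] [v [Q [vP QP ftP]]].
have nu1 := level_ge1 (ltn_ord k); have /andP[n1 n2] := nkeep_itv k.
have nu0 := level_gt0 k.
set nu := level k in nu0 nu1 n1 n2 Sn Sinf S1.
have k1 : 1 <= k.+1%:R :> R by rewrite ler1n.
have kE : k%:R = k.+1%:R - 1 :> R by rewrite natrS_sub1.
have ngt0 : 1 <= (nkeep D k)%:R :> R.
  by rewrite ler1n -(ltr0n R); lra.
have lam0 : 0 < s / nu by rewrite divr_gt0.
have S2 : (#|S| <= 2 * nkeep D k)%N.
  apply: (@ltnS_natr R); rewrite natrM; lra.
have Sp : (#|S| <= nkeep D k + (#|S| - nkeep D k))%N by rewrite -leq_subLR.
have pE : (#|S| - nkeep D k)%:R <= nu / 320.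
  have [le|lt] := leqP #|S| (nkeep D k); last by rewrite natrB 1?ltnW //; lra.
  by have /eqP -> := le; rewrite divr_ge0 // ltW.
(* The noise is measured in units of s / [level k], so its weight is at most (1 + 652 k) [level k];
   with the head this stays below [crowd_size k]. *)
have exE : excess (cell w (k := k)) (weight (D := D) g (s / nu) S) <= nu / 2048 * (ntrial D k)%:R.
  apply: le_trans (crowd_bound_le k).
  apply: uncrowded_excess wk _ _; first exact: weight01.
  apply: (@le_trans _ _ (#|S|%:R + (1 + 652 * k%:R) * nu)).
    rewrite -sum1_card natr_sum [in X in _ <= X + _]big_mkcond /=.
    apply: (@le_trans _ _ (\sum_j (if j \in S then 1 else 0) + 
       \sum_(j | j \notin S) `|g j 0| / (s / nu))); last first.
      have nuE : (1 + 652 * k%:R) * nu * (s / nu) = (1 + 652 * k%:R) * s.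
        by field; rewrite gt_eqF.
      by rewrite lerD2l -mulr_suml ler_pdivrMr // nuE.
    rewrite [X in _ + X]big_mkcond -big_split /=; apply: ler_sum => j _.
    rewrite /weight; case: ifP => _ /=; first by rewrite addr0.
    by rewrite add0r ge_min lexx orbT.
  have := truncn_gt (700 * k.+1%:R * nu); rewrite -/(crowd_size k).
  rewrite kE; nra.
have X0 : 0 <= 320 * (s / nu) by lra.
have [S' [S'n S'inf S'1]] := pass_progress lam0 vP QP ftP (ntrial_gt0 k) X0 Sp S2 Sinf S1 exE.
exists S'; rewrite levelS -/nu; split; clear v Q vP QP ftP exE wk.
- have n0 : 0 <= (nkeep D k.+1)%:R :> R by [].
  (* Here p <= nu / 320 and Ex = nu / 2048, and 10 / 320 + 62 / 2048 <= 1 / 16. This is half of the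
     next level. *)
  have S'nu : #|S'|%:R <= nu / 16 by lra.
  have /andP[_ n'2] := nkeep_itv k.+1; rewrite levelS -/nu in n'2.
  (* If the next [nkeep] is 0, the level is below 1 and the head is empty. Otherwise the level is
     below twice [nkeep], so half of it is at most [nkeep]. *)
  have [E0|n'1] := posnP (nkeep D k.+1).
    have -> : #|S'| = 0%N.
      apply/eqP; rewrite -leqn0; apply: (@ltnS_natr R); rewrite E0 in n'2; lra.
    lra.
  have : 1 <= (nkeep D k.+1)%:R :> R by rewrite ler1n.
  lra.
- move=> j /S'inf; rewrite !mxE => h; apply: le_trans h _.
  have -> : s / (nu / 8) = 8 * (s / nu) by field; rewrite gt_eqF.
  lra.
have e : \sum_(j | j \notin S') `|(g - ft) j 0| = \sum_(j | j \notin S') `|g j 0 - ft j 0|.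
  by apply: eq_bigr => j _; rewrite !mxE.
rewrite e; apply: le_trans S'1 _.
have : (nkeep D k)%:R * (s / nu) <= s.
  by rewrite mulrA ler_pdivrMr // mulrC ler_wpM2l // ltW.
lra.
Qed.

(** The head consists of the m largest entries and of those that are too large for the bound off the
    head; by Markov's inequality there are at most m / 320 of the latter. *)
Lemma residual_bound_start (s : R) (f fm : 'cV[R]_d) :
  best_approx m f fm -> l1norm (f - fm) < s -> residual_bound s 0 f.
Proof.
move=> [Q [_ cQ _] fmE] fs.
have m0 : 0 < (m%:R : R) by rewrite ltr0n.
have tail : \sum_(j | j \notin Q) `|f j 0| = l1norm (f - fm).
  rewrite /l1norm big_mkcond; apply: eq_bigr => j _; rewrite !mxE fmE.
  by case: (j \in Q); rewrite ?subrr ?normr0 ?subr0.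
have s0 : 0 < s by apply: le_lt_trans fs; rewrite -tail sumr_ge0.
have l0 : level 0 = m%:R by rewrite /level expr0 divr1.
pose P := [set j | (j \notin Q) && (320 * (s / m%:R) < `|f j 0|)].
exists (Q :|: P); rewrite l0; split.
- have Qm : #|Q|%:R <= (nkeep D 0)%:R :> R.
    rewrite ler_nat /= expr0 divr1 natrK cQ; exact: geq_minl.
  have Pm : #|P|%:R <= m%:R / 320 :> R.
    have : #|P|%:R * (320 * (s / m%:R)) <= s.
      apply: le_trans (ltW fs); rewrite -tail -sum1_card natr_sum mulr_suml.
      rewrite big_mkcond [leRHS]big_mkcond /=; apply: ler_sum => j _; rewrite inE.
      by case: (j \in Q) => //=; case: ifP => // /ltW; rewrite mul1r.
    move=> h; suff : #|P|%:R * 320 <= m%:R :> R by lra.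
    rewrite -(ler_pM2r (divr_gt0 s0 m0)) -mulrA; apply: le_trans h _.
    by rewrite mulrC divfK // gt_eqF.
  have : (#|Q :|: P| <= #|Q| + #|P|)%N by exact: leq_card_setU.
  rewrite -(ler_nat R) natrD; lra.
- move=> j; rewrite !inE negb_or => /andP[-> /=]; by rewrite -leNgt.
rewrite mulr0 addr0 mul1r; apply: le_trans (ltW fs); rewrite -tail.
rewrite big_mkcond [leRHS]big_mkcond; apply: ler_sum => j _.
by rewrite !inE; case: (j \in Q) => //=; case: ifP.
Qed.

(** After the last pass the level is below 1, which leaves no room for a head: all that remains is
    noise. *)
Lemma residual_bound_end (s : R) (g : 'cV[R]_d) :
  residual_bound s (npass D) g -> l1norm g <= (1 + 652 * (npass D)%:R) * s.
Proof.
case=> S [Sn _ S1]; have nu1 := level_npass_lt1.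
have /andP[n1 _] := nkeep_itv (npass D).
have n0 : nkeep D (npass D) = 0%N.
  apply/eqP; rewrite -leqn0; apply: (@ltnS_natr R); lra.
have S0 : S = set0.
  apply/eqP; rewrite -cards_eq0 -leqn0; apply: (@ltnS_natr R).
  by rewrite n0 in Sn; lra.
apply: le_trans S1; rewrite /l1norm [leRHS](eq_bigl xpredT) // => j.
by rewrite S0 inE.
Qed.

Lemma chaining_pursuit_residual (w : sample D) (f fm : 'cV[R]_d) (h : nat -> 'cV[R]_d) :
    spread w -> best_approx m f fm -> h 0%N = 0 ->
    (forall k : 'I_(npass D), pass k (Phi R w *m f - Phi R w *m h k) (h k.+1 - h k)) ->
  l1norm (f - h (npass D)) <= (1 + 652 * (npass D)%:R) * l1norm (f - fm).
Proof.
move=> wS ffm h0 hP; set c := 1 + _; set sigma := l1norm (f - fm).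
have c0 : 0 < c by rewrite ltr_wpDr // mulr_ge0.
(* The strict inequality makes s, and with it the threshold s / [level k], positive even for an
   exactly sparse signal. *)
have all_s s : sigma < s -> l1norm (f - h (npass D)) <= c * s.
  move=> ss; apply: residual_bound_end.
  have sg0 : 0 <= sigma by apply: sumr_ge0.
  suff all_k k : (k <= npass D)%N -> residual_bound s k (f - h k) by exact: all_k.
  elim: k => [_|k IHk kK].
    by rewrite h0 subr0; apply: residual_bound_start ffm ss.
  have := hP (Ordinal kK); rewrite -mulmxBr => hk.
  have := @residual_bound_pass s w (Ordinal kK) _ _ (le_lt_trans sg0 ss) wS (IHk (ltnW kK)) hk.
  by rewrite opprB addrA subrK.
rewrite leNgt; apply/negP => lt.
have lt' : sigma < l1norm (f - h (npass D)) / c by rewrite ltr_pdivlMr // mulrC.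
(* The midpoint is still above sigma, yet c times it is below the error. *)
have := all_s ((sigma + l1norm (f - h (npass D)) / c) / 2).
have : c * (l1norm (f - h (npass D)) / c) = l1norm (f - h (npass D)).
  by rewrite mulrC divfK // gt_eqF.
move=> e /(_ _); nra.
Qed.

Lemma spread_recovery (w : sample D) (f fm fhat : 'cV[R]_d) :
    spread w -> best_approx m f fm ->
    chaining_pursuit (Phi R w) (Phi R w *m f) fhat ->
  [/\ (nnz fhat <= m)%N,
      l1norm (f - fhat) <= 1307 * (1 + ln m%:R) * l1norm (f - fm) &
      fm = f -> fhat = f].
Proof.
move=> wS ffm [h [h0 hP hh]].
have err : l1norm (f - fhat) <= 1307 * (1 + ln m%:R) * l1norm (f - fm).
  (* 2 (1 + 652 (1 + ln m)) + 1 is at most 1307 (1 + ln m). *)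
  apply: le_trans (best_approx_near ffm hh) _.
  have := chaining_pursuit_residual wS ffm h0 hP.
  have := ler_wpM2r (l1norm_ge0 (f - fm)) npass_le.
  have := mulr_ge0 ln_m_ge0 (l1norm_ge0 (f - fm)); lra.
split=> //; first exact: nnz_best_approx hh.
move=> ffmE; apply/esym/eqP; rewrite -subr_eq0; apply/eqP/l1norm_eq0.
apply: le_trans err _; rewrite ffmE subrr.
by rewrite /l1norm big1 ?mulr0 // => j _; rewrite mxE normr0.
Qed.

End Recovery.

(** * Timed list operations *)

Section Timed.
Local Open Scope nat_scope.

Lemma bind_val (A B : Type) (p : timed A) (q : A -> timed B) :
  (bind p q).1 = (q p.1).1.
Proof. by []. Qed.

Lemma bind_time (A B : Type) (p : timed A) (q : A -> timed B) :
  (bind p q).2 = p.2 + (q p.1).2.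
Proof. by []. Qed.

Lemma tmap_val (X Y : Type) (body : X -> timed Y) xs :
  (tmap body xs).1 = [seq (body x).1 | x <- xs].
Proof. by elim: xs => //= x xs ->. Qed.

Lemma tmap_time (X Y : Type) (body : X -> timed Y) c xs :
  (forall x, (body x).2 <= c) -> (tmap body xs).2 <= size xs * c.+1 + 1.
Proof.
move=> bc; elim: xs => [|x xs IH] //=; have := bc x.
rewrite mulSn; move: IH; rewrite /=.
move: (tmap _ _).2 (body x).2 (size xs * c.+1) => a b e; lia.
Qed.

Lemma tmap_time_sum (X Y : Type) (body : X -> timed Y) (c : X -> nat) xs :
  (forall x, (body x).2 <= c x) ->
  (tmap body xs).2 <= \sum_(x <- xs) (c x).+1 + 1.
Proof.
move=> bc; elim: xs => [|x xs IH] /=; first by rewrite big_nil.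
rewrite big_cons; have := bc x; move: IH; rewrite /=.
move: (tmap _ _).2 (body x).2 (\sum_(_ <- xs) _) (c x) => a b e f; lia.
Qed.

Lemma tfold_val (A X : Type) (body : A -> X -> timed A) a xs :
  (tfold body a xs).1 = foldl (fun a x => (body a x).1) a xs.
Proof. by elim: xs a => //= x xs IH a; rewrite IH. Qed.

Lemma tfold_time_sum (A X : Type) (body : A -> X -> timed A) (c : X -> nat) a xs :
  (forall a x, (body a x).2 <= c x) ->
  (tfold body a xs).2 <= \sum_(x <- xs) (c x).+1 + 1.
Proof.
move=> bc; elim: xs a => [|x xs IH] a /=; first by rewrite big_nil.
rewrite big_cons; have := bc a x; have := IH (body a x).1; rewrite /=.
move: (tfold _ _ _).2 (body a x).2 (\sum_(_ <- xs) _) (c x) => u b e f; lia.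
Qed.

Lemma tfold_time (A X : Type) (body : A -> X -> timed A) c a xs :
  (forall a x, (body a x).2 <= c) -> (tfold body a xs).2 <= size xs * c.+1 + 1.
Proof.
move=> bc; have := tfold_time_sum a xs (c := fun=> c) bc.
by rewrite big_const_seq count_predT iter_addn_0 mulnC.
Qed.

Lemma tpmap_val (X Y : Type) (body : X -> timed (option Y)) xs :
  (tpmap body xs).1 = pmap (fun x => (body x).1) xs.
Proof. by rewrite /tpmap /= tmap_val; elim: xs => //= x xs ->; case: (body x).1. Qed.

Lemma tpmap_time_sum (X Y : Type) (body : X -> timed (option Y)) (c : X -> nat) xs :
  (forall x, (body x).2 <= c x) ->
  (tpmap body xs).2 <= \sum_(x <- xs) (c x).+2 + 1.
Proof.
move=> bc; rewrite /tpmap /=; have := tmap_time_sum xs bc.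
rewrite tmap_val size_map; have -> : \sum_(x <- xs) (c x).+2 = \sum_(x <- xs) (c x).+1 + size xs.
  by rewrite -sum1_size -big_split /=; apply: eq_bigr => x _; rewrite [RHS]addn1.
lia.
Qed.

Lemma ttake_time (X : Type) n (s : seq X) : (ttake n s).2 <= n.+1.
Proof. by rewrite /ttake /= ltnS size_take; case: ltnP. Qed.

Section Sort.
Variables (X : eqType) (le : rel X).

Lemma merge_pairs_size ss : size (merge_pairs le ss).1 = uphalf (size ss).
Proof.
have [n] := ubnP (size ss); elim: n ss => // n IH [|s1 [|s2 ss]] //=.
by rewrite !ltnS => ns; rewrite IH // ltnW.
Qed.

Lemma merge_pairs_perm ss : perm_eq (flatten (merge_pairs le ss).1) (flatten ss).
Proof.
have [n] := ubnP (size ss); elim: n ss => // n IH [|s1 [|s2 ss]] //=.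
rewrite !ltnS => ns; rewrite catA; apply: perm_cat; last by apply: IH; apply: ltnW.
by rewrite perm_merge.
Qed.

Lemma merge_pairs_sorted ss : total le ->
  all (sorted le) ss -> all (sorted le) (merge_pairs le ss).1.
Proof.
move=> tot; have [n] := ubnP (size ss); elim: n ss => // n IH [|s1 [|s2 ss]] //=.
rewrite !ltnS => ns /and3P[s1s s2s sss]; rewrite merge_sorted //=.
by apply: IH => //; apply: ltnW.
Qed.

Lemma merge_pairs_time ss :
  (merge_pairs le ss).2 <= size (flatten ss) + 2 * size ss + 1.
Proof.
have [n] := ubnP (size ss); elim: n ss => // n IH [|s1 [|s2 ss]] //=; try lia.
rewrite !ltnS => ns; have := IH ss (ltnW ns); rewrite !size_cat.
move: (merge_pairs _ _).2 (size (flatten _)) => a b; lia.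
Qed.

Lemma merge_roundsE fuel s1 s2 ss :
  merge_rounds le fuel.+1 [:: s1, s2 & ss] =
  bind (merge_pairs le [:: s1, s2 & ss]) (merge_rounds le fuel).
Proof. by []. Qed.

Lemma merge_rounds_val1 fuel s1 s2 ss :
  (merge_rounds le fuel.+1 [:: s1, s2 & ss]).1 =
  (merge_rounds le fuel (merge_pairs le [:: s1, s2 & ss]).1).1.
Proof. by []. Qed.

(** One unit of fuel per round is enough, because a round on two or more lists lowers their
    number. *)
Lemma merge_rounds_val fuel ss : total le -> size ss <= fuel.+1 ->
    all (sorted le) ss ->
  sorted le (merge_rounds le fuel ss).1 /\
  perm_eq (merge_rounds le fuel ss).1 (flatten ss).
Proof.
move=> tot; elim: fuel ss => [|fuel IH] [|s1 [|s2 ss]] // size_ss sort_ss;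
  try by rewrite /= cats0; case/andP: sort_ss.
rewrite merge_rounds_val1.
have := merge_pairs_sorted tot sort_ss.
have := merge_pairs_perm [:: s1, s2 & ss].
have := merge_pairs_size [:: s1, s2 & ss].
move: (merge_pairs _ _).1 => ss' size' perm' sort'.
have [|S P] := IH ss' _ sort'.
  move: size_ss; rewrite size' /= uphalf_half !ltnS => h.
  by have := odd_double_half (size ss); lia.
by split=> //; apply: seq.perm_trans P perm'.
Qed.

(** A round halves the number of lists, rounding up, so 2^j lists need j rounds. The bound n on the
    number of lists makes the cost the same in each round. *)
Lemma merge_rounds_time fuel ss n j : size ss <= 2 ^ j -> size ss <= n ->
  (merge_rounds le fuel ss).2 <= j * (size (flatten ss) + 2 * n + 1) + 1.
Proof.
elim: j fuel ss => [|j IH] [|fuel] [|s1 [|s2 ss]] //; try by rewrite /= addn1.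
move=> jss nss; rewrite merge_roundsE.
have := merge_pairs_time [:: s1, s2 & ss].
have := perm_size (merge_pairs_perm [:: s1, s2 & ss]).
have := merge_pairs_size [:: s1, s2 & ss].
move: (merge_pairs le [:: s1, s2 & ss]) => [ss' c] size' perm' time'.
rewrite /= in size' perm' time' jss nss *.
have h1 : size ss' <= 2 ^ j.
  move: jss; rewrite size' expnS uphalf_half; have := odd_double_half (size ss); lia.
have h2 : size ss' <= n.
  move: nss; rewrite size' uphalf_half; have := odd_double_half (size ss); lia.
have := IH fuel ss' h1 h2; rewrite perm'.
rewrite [j.+1 * _]mulSn.
move: (merge_rounds _ _ _).2 (size (s1 ++ _)) (j * _) time' => a b e; lia.
Qed.

Lemma tsort_val s : total le -> sorted le (tsort le s).1 /\ perm_eq (tsort le s).1 s.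
Proof.
move=> tot; rewrite /tsort /= tmap_val /=.
have fl : flatten [seq [:: x] | x <- s] = s by elim: s => //= x s ->.
have := @merge_rounds_val (size s) [seq [:: x] | x <- s] tot.
by rewrite fl size_map; apply => //; apply/allP => _ /mapP[x _ ->].
Qed.

Lemma tsort_time s j : size s <= 2 ^ j -> (tsort le s).2 <= j.+1 * (3 * size s + 2).
Proof.
move=> sj; rewrite /tsort /= tmap_val /=.
have fl : flatten [seq [:: x] | x <- s] = s by elim: s {sj} => //= x s ->.
have := @tmap_time _ _ (fun x : X => step [:: x]) 1 s (fun=> leqnn _).
have := @merge_rounds_time (size s) [seq [:: x] | x <- s] (size s) j.
rewrite size_map fl => /(_ sj (leqnn _)).
move: (merge_rounds _ _ _).2 (tmap _ _).2 => a b h1 h2.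
rewrite mulSn; nia.
Qed.

End Sort.

Section Runs.
Variables (I X : eqType).
Implicit Types s : seq (I * X).

Lemma runs_time s : (runs s).2 = size s + 1.
Proof. by elim: s => //= -[j x] s IH /=; rewrite IH; lia. Qed.

Definition add_run (e : I * X) (gs : seq (I * seq X)) : seq (I * seq X) :=
  if gs is (j, xs) :: gs' then
    if e.1 == j then (e.1, e.2 :: xs) :: gs' else (e.1, [:: e.2]) :: gs
  else [:: (e.1, [:: e.2])].

Lemma runs_cons e s : (runs (e :: s)).1 = add_run e (runs s).1.
Proof. by case: e. Qed.

Lemma runs_size s : sumn [seq size g.2 | g <- (runs s).1] = size s.
Proof.
elim: s => // e s; rewrite runs_cons [size (e :: s)]/= => <-.
by case: (runs s).1 => [|[j xs] gs] //=; case: eqP.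
Qed.

Lemma runs_size_le s : size (runs s).1 <= size s.
Proof.
elim: s => // e s; rewrite runs_cons; case: (runs s).1 => [|[j xs] gs] //=.
by case: eqP => //= _ /ltnW.
Qed.

Lemma runs_keys s : [seq g.1 | g <- (runs s).1] =i [seq e.1 | e <- s].
Proof.
elim: s => // e s; rewrite runs_cons; case: (runs s).1 => [|[j xs] gs] /= IH k.
  by rewrite [RHS]in_cons -IH in_cons.
by case: eqP => [->|_]; rewrite /= [RHS]in_cons -IH !in_cons // orbA orbb.
Qed.

Variable (lek : rel I).
Hypotheses (lek_trans : transitive lek) (lek_anti : antisymmetric lek).

(** [runs] only joins neighbours, but in a list sorted by key all items with one key are
    adjacent. *)
Lemma runs_val s : sorted (fun e1 e2 => lek e1.1 e2.1) s ->
  uniq [seq g.1 | g <- (runs s).1] /\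
  (runs s).1 = [seq (j, [seq e.2 | e <- s & e.1 == j]) | j <- [seq g.1 | g <- (runs s).1]].
Proof.
elim: s => // -[j x] s IH js; rewrite runs_cons.
have ss := path_sorted js; have [U E] := IH ss.
have jall : {in s, forall e, lek j e.1}.
  by move=> e es; have /allP := order_path_min (fun a b c => @lek_trans a.1 b.1 c.1) js; apply.
have hd : forall k, head k [seq g.1 | g <- (runs s).1] = head k [seq e.1 | e <- s].
  move=> k; case: (s) => // e s'; rewrite runs_cons.
  by case: (runs s').1 => [|[k' ?] ?] //=; case: eqP.
have mem := runs_keys s.
move: U E mem hd; case: (runs s).1 => [|[j' xs] gs] /= U E mem hd.
  case: s mem {IH ss jall js hd E U} => [_|e s /(_ e.1)]; first by rewrite /= eqxx.
  by rewrite !inE eqxx.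
have [jj|ne] := eqVneq j j'.
  subst j'; split; first exact: U.
  move: E U => /= [-> E] /andP[jgs Ugs]; rewrite eqxx.
  congr (_ :: _); rewrite {1}E; apply/eq_in_map => k kgs.
  by have /negbTE -> : j != k by apply: contraNneq jgs => ->.
have js' : j \notin [seq e.1 | e <- s].
  apply: contra ne => /mapP[e es jE].
  have e0 := hd j; case: s es ss e0 {IH js mem hd E} jall => [|e1 s] //= es ss -> jall.
  apply/eqP/lek_anti; rewrite jall ?mem_head //= jE.
  move: es; rewrite inE => /predU1P[ee | es].
    by rewrite ee; have := jall _ (mem_head e1 s); rewrite jE ee.
  by have /allP := order_path_min (fun a b c => @lek_trans a.1 b.1 c.1) ss; apply.
have jK : j \notin j' :: [seq g.1 | g <- gs] by rewrite [_ \in _]mem.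
split; first by rewrite /= jK.
rewrite /= eqxx; have -> : [seq e <- s | e.1 == j] = [::].
  apply/eqP; rewrite -size_eq0 size_filter -leqn0 leqNgt -has_count.
  apply: contra js' => /hasP[e es /eqP <-]; exact: map_f.
congr (_ :: _); rewrite {1}E -map_cons; apply/eq_in_map => k kgs.
by have /negbTE -> : j != k by apply: contraNneq jK => ->.
Qed.

End Runs.
End Timed.

(** * The implementation of a pass *)

Section Implementation.
Variables (R : realType) (D : design).
Notation d := (dim D).
Notation sketch := ('cV[R]_(nsketch D)).
Implicit Types (V : sketch) (b : block D) (e : 'I_d * R).

(** Horner's rule, starting from the most significant digit. *)
Lemma foldl_digits L (B : 'I_L -> bool) :
  foldl (fun p i => p.*2 + B i)%N 0%N (rev (enum 'I_L)) = (\sum_(i < L) B i * 2 ^ i)%N.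
Proof.
rewrite foldl_rev; elim: L B => [|L IH] B; first by rewrite enum_ord0 big_ord0.
rewrite enum_ordSl /= foldr_map big_ord_recl /= muln1 (IH (fun i => B (lift ord0 i))).
rewrite addnC; congr (_ + _)%N; rewrite -muln2 big_distrl /=.
by apply: eq_bigr => i _; rewrite -mulnA -expnSr.
Qed.

Lemma tdecode_val V (al : arow D) :
  (tdecode V al).1 = omap (fun j => (j, value V al)) (insub (position V al)).
Proof.
rewrite /tdecode /= tfold_val /position -foldl_digits.
by congr (omap _ (insub _)).
Qed.

Lemma by_magnitude_total : total (@by_magnitude R D).
Proof. by move=> e1 e2; apply: le_total. Qed.

Lemma by_magnitude_trans : transitive (@by_magnitude R D).
Proof. by move=> e2 e1 e3 h1 h2; apply: le_trans h2 h1. Qed.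

Lemma by_position_magnitude_total : total (@by_position_magnitude R D).
Proof.
move=> [i x] [j y]; rewrite /by_position_magnitude /=.
by case: (ltngtP i j) => [_|_|/val_inj ->] //=; rewrite ?orbT ?eqxx ?le_total.
Qed.

Lemma by_position_magnitude_trans : transitive (@by_position_magnitude R D).
Proof.
move=> [j y] [i x] [k z]; rewrite /by_position_magnitude /=.
case/orP=> [ij|/andP[/eqP -> yx]] /orP[jk|/andP[/eqP <- zy]].
- by rewrite (ltn_trans ij jk).
- by rewrite ij.
- by rewrite jk.
- by rewrite eqxx (le_trans zy yx) orbT.
Qed.

Lemma by_position_value_total : total (@by_position_value R D).
Proof.
move=> [i x] [j y]; rewrite /by_position_value /=.
by case: (ltngtP i j) => [_|_|/val_inj ->] //=; rewrite ?orbT ?eqxx ?le_total.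
Qed.

Lemma by_position_value_trans : transitive (@by_position_value R D).
Proof.
move=> [j y] [i x] [k z]; rewrite /by_position_value /=.
case/orP=> [ij|/andP[/eqP -> yx]] /orP[jk|/andP[/eqP <- zy]].
- by rewrite (ltn_trans ij jk).
- by rewrite ij.
- by rewrite jk.
- by rewrite eqxx (le_trans yx zy) orbT.
Qed.

Definition position_le : rel 'I_d := fun i j => (i <= j)%N.

Lemma position_le_trans : transitive position_le.
Proof. by move=> j i k; apply: leq_trans. Qed.

Lemma position_le_anti : antisymmetric position_le.
Proof. by move=> i j h; apply/val_inj/anti_leq. Qed.

Lemma sub_by_position_magnitude e1 e2 :
  by_position_magnitude e1 e2 -> position_le e1.1 e2.1.
Proof. by case/orP=> [/ltnW//|/andP[/eqP e _]]; rewrite /position_le e. Qed.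

Lemma sub_by_position_value e1 e2 :
  by_position_value e1 e2 -> position_le e1.1 e2.1.
Proof. by case/orP=> [/ltnW//|/andP[/eqP e _]]; rewrite /position_le e. Qed.

Lemma largest_take n (E : {set 'I_d}) (v : 'I_d -> R) (s : spikes R D) :
    sorted (@by_magnitude R D) s -> uniq [seq e.1 | e <- s] ->
    [seq e.1 | e <- s] =i E -> {in s, forall e, e.2 = v e.1} ->
  largest n E v [set j in [seq e.1 | e <- take n s]].
Proof.
move=> ss us sE sv.
have uE : #|E| = size s.
  by rewrite -(size_map (fun e => e.1)) -(card_uniqP us); apply: eq_card => j; rewrite sE.
split.
- apply/subsetP => j; rewrite inE -sE => /mapP[e es ->].
  by apply: map_f; apply: mem_take es.
- rewrite cardsE (card_uniqP _) ?map_take ?take_uniq // size_take size_map uE /minn.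
  by case: ltnP.
move=> i j; rewrite inE => /mapP[e et ->] /setDP[]; rewrite -sE => /mapP[e' es' ->].
rewrite inE => e't.
have e'd : e' \in drop n s.
  move: es'; rewrite -{1}(cat_take_drop n s) mem_cat => /orP[h|//].
  by case/negP: e't; apply: map_f.
move: ss; rewrite (sorted_pairwise by_magnitude_trans) -{1}(cat_take_drop n s).
rewrite pairwise_cat => /and3P[/allrelP /(_ _ _ et e'd)].
by rewrite /by_magnitude !sv ?(mem_take et).
Qed.

Lemma mem_decode_list V b e :
  (e \in pmap (fun n => (tdecode V (mkrow (b := b) n)).1) (enum 'I_(npart D (tag b)))) =
  [exists n, (position V (mkrow (b := b) n) == e.1) && (value V (mkrow (b := b) n) == e.2)].
Proof.
rewrite mem_pmap; apply/mapP/existsP => [[n _]|[n /andP[/eqP pn /eqP vn]]].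
  rewrite tdecode_val; case: insubP => //= j _ jn -[->] /=.
  by exists n; rewrite -jn !eqxx.
exists n; first by rewrite mem_enum.
by rewrite tdecode_val pn valK vn; case: e {pn vn}.
Qed.

(** After sorting by position and then by decreasing magnitude, the head of each run is the kept
    value; this head is the witness [v]. *)
Lemma ttrial_spec V b : exists v : 'I_d -> R,
  [/\ forall j, j \in decoded V b -> kept_value V b j (v j),
      uniq [seq e.1 | e <- (ttrial V b).1],
      largest (nkeep D (tag b)) (decoded V b) v
        [set j in [seq e.1 | e <- (ttrial V b).1]] &
      {in (ttrial V b).1, forall e, e.2 = v e.1}].
Proof.
set es0 := pmap (fun n => (tdecode V (mkrow (b := b) n)).1) (enum 'I_(npart D (tag b))).
pose s1 := (tsort (@by_position_magnitude R D) es0).1.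
pose f (g : 'I_d * seq R) := (g.1, head 0 g.2).
pose s3 := (tsort (@by_magnitude R D) [seq f g | g <- (runs s1).1]).1.
have tE : (ttrial V b).1 = take (nkeep D (tag b)) s3.
  rewrite /ttrial /bind /= /s3; congr (take _ (tsort _ _).1).
  by rewrite tmap_val /s1 /es0 -tpmap_val.
have [s1s s1p] := tsort_val es0 by_position_magnitude_total; rewrite -/s1 in s1s s1p.
have [s3s s3p] := tsort_val [seq f g | g <- (runs s1).1] by_magnitude_total.
rewrite -/s3 in s3s s3p.
have [gU gE] := runs_val position_le_trans position_le_anti (sub_sorted sub_by_position_magnitude s1s).
pose v j := head 0 [seq e.2 | e <- s1 & e.1 == j].
have fE : [seq f g | g <- (runs s1).1] = [seq (j, v j) | j <- [seq g.1 | g <- (runs s1).1]].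
  by rewrite gE -!map_comp.
have keysE : [seq e.1 | e <- [seq f g | g <- (runs s1).1]] = [seq g.1 | g <- (runs s1).1].
  by rewrite -map_comp.
have memE : [seq e.1 | e <- s3] =i decoded V b.
  move=> j; rewrite (perm_mem (perm_map _ s3p)) keysE runs_keys.
  rewrite (perm_mem (perm_map _ s1p)) inE.
  apply/mapP/existsP => [[e]|[n /eqP nj]].
    by rewrite mem_decode_list => /existsP[n /andP[ne _]] ->; exists n.
  exists (j, value V (mkrow n)) => //; rewrite mem_decode_list.
  by apply/existsP; exists n; rewrite nj !eqxx.
have vE : {in s3, forall e, e.2 = v e.1}.
  by move=> e; rewrite (perm_mem s3p) fE => /mapP[j _ ->].
have U3 : uniq [seq e.1 | e <- s3].
  by rewrite (perm_uniq (perm_map _ s3p)) keysE.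
exists v; split.
- move=> j; rewrite inE => /existsP[n0 /eqP n0j].
  set s := [seq e <- s1 | e.1 == j].
  have sE e : (e \in s) = 
      [exists n, (position V (mkrow (b := b) n) == j) &&
                 (value V (mkrow (b := b) n) == e.2)] && (e.1 == j).
    rewrite mem_filter (perm_mem s1p) mem_decode_list andbC.
    by have [->//|_] := eqVneq e.1 j; rewrite !andbF.
  have ss : sorted (@by_position_magnitude R D) s.
    exact: sorted_filter by_position_magnitude_trans _ _ s1s.
  have n0s : (j, value V (mkrow n0)) \in s.
    by rewrite sE eqxx andbT; apply/existsP; exists n0; rewrite n0j !eqxx.
  rewrite /v -/s; case: s sE ss n0s => // e s sE ss _ /=.
  have := sE e; rewrite mem_head => /esym/andP[/existsP[n /andP[/eqP nj /eqP ne]] ej].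
  split; first by exists n.
  move=> n' n'j; have : (j, value V (mkrow n')) \in e :: s.
    by rewrite sE eqxx andbT; apply/existsP; exists n'; rewrite n'j !eqxx.
  rewrite inE => /predU1P[<- //|es].
  have /allP /(_ _ es) := order_path_min by_position_magnitude_trans ss.
  by rewrite /by_position_magnitude (eqP ej) ltnn eqxx.
- by rewrite tE map_take take_uniq.
- by rewrite tE; apply: largest_take.
by move=> e; rewrite tE => /mem_take; apply: vE.
Qed.
End Implementation.

(** * The estimates of a pass and their medians *)

Section PassSpec.
Variables (R : realType) (D : design).
Notation d := (dim D).
Notation sketch := ('cV[R]_(nsketch D)).
Implicit Types (V : sketch) (b : block D) (e : 'I_d * R).

Lemma vector_of_map (K : seq 'I_d) (X : 'I_d -> R) j : uniq K ->
  vector_of (D := D) [seq (i, X i) | i <- K] j 0 = if j \in K then X j else 0.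
Proof.
move=> uK; rewrite /vector_of mxE big_map /=; case: ifPn => jK.
  rewrite (eq_bigl (pred1 j)) ?big_pred1_seq //.
  by rewrite -big_filter filter_pred1_uniq // big_seq1.
rewrite big_seq_cond big1 // => i /andP[iK /eqP ij].
by rewrite -ij iK in jK.
Qed.

Lemma filter_key (es : spikes R D) (v : 'I_d -> R) j :
    uniq [seq e.1 | e <- es] -> {in es, forall e, e.2 = v e.1} ->
  [seq e.2 | e <- es & e.1 == j] = if j \in [seq e.1 | e <- es] then [:: v j] else [::].
Proof.
elim: es => //= e es IH /andP[nes ues] ev.
have ev' : {in es, forall e, e.2 = v e.1}.
  by move=> e' es'; apply: ev; rewrite inE es' orbT.
rewrite inE eq_sym; have [ej|ne] := eqVneq e.1 j; last exact: IH.
by rewrite /= IH // -ej (negbTE nes) ev ?mem_head.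
Qed.

(** Counting from 0, the entries up to index n are at most the entry n, and those from n on are at
    least it; n + 1 and size - n are both at least half of the size. *)
Lemma is_median_sorted (xs : seq R) : sorted <=%R xs -> (0 < size xs)%N ->
  is_median xs (nth 0 xs (size xs)./2).
Proof.
move=> ss xs0; set n := (size xs)./2.
have nE : (n.*2 <= size xs <= n.*2.+1)%N.
  by rewrite -(odd_double_half (size xs)) leq_addl -addn1 addnC leq_add2l leq_b1.
clearbody n; have nxs : (n < size xs)%N by lia.
have mono i k : (i <= k < size xs)%N -> nth 0 xs i <= nth 0 xs k.
  case/andP=> ik kxs; apply: (sorted_leq_nth le_trans le_refl) => //.
  exact: leq_ltn_trans ik kxs.
split.
  have : (n.+1 <= count (fun y => (y <= nth 0 xs n)%R) xs)%N.
    rewrite -(cat_take_drop n.+1 xs) count_cat cat_take_drop.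
    have : all (fun y => (y <= nth 0 xs n)%R) (take n.+1 xs).
      apply/(all_nthP 0) => i; rewrite size_takel // => ni.
      by rewrite nth_take // mono // -ltnS ni.
    by rewrite all_count => /eqP ->; rewrite size_takel // leq_addr.
  by move: nE; move: (count _ _) => c; lia.
have : (size xs - n <= count (fun y => (nth 0 xs n <= y)%R) xs)%N.
  rewrite -[X in count _ X](cat_take_drop n xs) count_cat.
  have : all (fun y => (nth 0 xs n <= y)%R) (drop n xs).
    apply/(all_nthP 0) => i; rewrite size_drop => ni.
    by rewrite nth_drop; apply: mono; rewrite leq_addr -ltn_subRL.
  by rewrite all_count => /eqP ->; rewrite size_drop leq_addl.
by move: nE; move: (count _ _) => c; lia.
Qed.

Lemma perm_median (s1 s2 : seq R) x : perm_eq s1 s2 -> is_median s1 x -> is_median s2 x.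
Proof. by move=> s12; rewrite /is_median (perm_size s12) !(permP s12). Qed.

Definition trials V (k : 'I_(npass D)) : spikes R D :=
  foldl (fun acc t => (ttrial V (mkblock t)).1 ++ acc) [::] (enum 'I_(ntrial D k)).

Lemma perm_trials V (k : 'I_(npass D)) :
  perm_eq (trials V k)
    (flatten [seq (ttrial V (mkblock t)).1 | t <- enum 'I_(ntrial D k)]).
Proof.
rewrite /trials -[X in perm_eq _ X]cats0; elim: (enum _) [::] => [|t ts IH] acc //=.
apply: seq.perm_trans (IH _) _; by rewrite perm_catCA catA.
Qed.

Definition estimates V (k : 'I_(npass D)) j : seq R :=
  [seq e.2 | e <- (tsort (@by_position_value R D) (trials V k)).1 & e.1 == j].

Definition often (k : 'I_(npass D)) (xs : seq R) : bool :=
  (9 * ntrial D k <= 10 * size xs)%N.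

Definition add_trial V (k : 'I_(npass D)) acc (t : 'I_(ntrial D k)) : timed (spikes R D) :=
  bind (ttrial V (mkblock t)) (fun es => charge (size es).+1 (es ++ acc)).

Definition select (k : 'I_(npass D)) (g : 'I_d * seq R) : timed (option ('I_d * R)) :=
  bind (charge (size g.2).+1 (size g.2)) (fun n =>
    if (9 * ntrial D k <= 10 * n)%N
    then charge n.+1 (Some (g.1, nth 0 g.2 n./2))
    else step None).

Lemma tpassE V (k : 'I_(npass D)) :
  tpass V k =
  bind (tfold (@add_trial V k) [::] (enum 'I_(ntrial D k))) (fun es =>
  bind (tsort (@by_position_value R D) es) (fun s =>
  bind (runs s) (fun gs => tpmap (select k) gs))).
Proof. by []. Qed.

Lemma tpass_val V (k : 'I_(npass D)) : exists2 K : seq 'I_d,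
    uniq K /\ K =i [seq e.1 | e <- trials V k] &
  (tpass V k).1 = [seq (j, nth 0 (estimates V k j) (size (estimates V k j))./2)
                     | j <- K & often k (estimates V k j)].
Proof.
set s := (tsort (@by_position_value R D) (trials V k)).1.
have [ss sp] := tsort_val (trials V k) (@by_position_value_total R D).
rewrite -/s in ss sp.
have [gU gE] := runs_val (@position_le_trans D) (@position_le_anti D)
  (sub_sorted (@sub_by_position_value R D) ss).
exists [seq g.1 | g <- (runs s).1].
  by split=> // j; rewrite runs_keys (perm_mem (perm_map _ sp)).
have -> : (tpass V k).1 = pmap (fun g : 'I_d * seq R =>
    if often k g.2 then Some (g.1, nth 0 g.2 (size g.2)./2) else None) (runs s).1.
  rewrite tpassE 3!bind_val tpmap_val tfold_val; apply: eq_pmap => g.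
  by rewrite /often /=; case: ifP.
rewrite {1}gE; elim: [seq g.1 | g <- (runs s).1] => //= j K IH.
by rewrite -/(estimates V k j); case: ifP => _ /=; rewrite IH.
Qed.

Lemma pass_tpass V (k : 'I_(npass D)) : (0 < ntrial D k)%N -> pass k V (vector_of (tpass V k).1).
Proof.
move=> T0.
have /choice[v vP] : forall t : 'I_(ntrial D k), exists v : 'I_d -> R,
  [/\ forall j, j \in decoded V (mkblock t) -> kept_value V (mkblock t) j (v j),
      uniq [seq e.1 | e <- (ttrial V (mkblock t)).1],
      largest (nkeep D k) (decoded V (mkblock t)) v
        [set j in [seq e.1 | e <- (ttrial V (mkblock t)).1]] &
      {in (ttrial V (mkblock t)).1, forall e, e.2 = v e.1}].
  by move=> t; apply: ttrial_spec.
pose Q t := [set j in [seq e.1 | e <- (ttrial V (mkblock (k := k) t)).1]].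
exists v, Q; split.
- by move=> t; have [] := vP t.
- by move=> t; have [] := vP t.
have pE j : perm_eq (estimates V k j) [seq v t j | t <- enum 'I_(ntrial D k) & j \in Q t].
  have [_ sp] := tsort_val (trials V k) (@by_position_value_total R D).
  apply: seq.perm_trans (perm_map _ (perm_filter _ (seq.perm_trans sp (perm_trials V k)))) _.
  rewrite filter_flatten map_flatten -map_comp.
  elim: (enum _) => //= t ts IH; have [_ ut _ et] := vP t.
  rewrite (filter_key j ut et) [j \in Q t]inE.
  by case: ifP => _ //=; rewrite perm_cons.
have cE j : size (estimates V k j) = #|[set t | j \in Q t]|.
  by rewrite (perm_size (pE j)) size_map size_filter count_enum.
have [K [uK KE] ->] := tpass_val V k.
move=> j; rewrite vector_of_map ?filter_uniq // mem_filter -cE -/(often k (estimates V k j)).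
case of_j: (often k (estimates V k j)) => //=.
(* As there is at least one trial, a position that meets the quota has an estimate, so it occurs in
   the sorted list and its median exists. *)
have n0 : (0 < size (estimates V k j))%N by move: of_j; rewrite /often; lia.
have -> : j \in K.
  rewrite KE; have : has (fun e => e.1 == j) (trials V k).
    rewrite has_count -size_filter.
    have [_ sp] := tsort_val (trials V k) (@by_position_value_total R D).
    by move: n0; rewrite /estimates size_map !size_filter (permP sp).
  by move=> /hasP[e et /eqP <-]; apply: map_f.
apply: perm_median (pE j) _; apply: is_median_sorted => //.
rewrite sorted_map.
have [ss _] := tsort_val (trials V k) (@by_position_value_total R D).
have := sorted_filter (@by_position_value_trans R D) (fun e => e.1 == j) ss.
have : all (fun e => e.1 == j) [seq e <- (tsort (@by_position_value R D) (trials V k)).1 | e.1 == j].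
  exact: filter_all.
apply: sub_in_sorted => e1 e2 /eqP e1j /eqP e2j.
by rewrite /by_position_value e1j e2j ltnn eqxx.
Qed.

Lemma size_ttrial V b : (size (ttrial V b).1 <= nkeep D (tag b))%N.
Proof. by rewrite /ttrial /bind /= size_take; case: ltnP. Qed.

Lemma size_trials V (k : 'I_(npass D)) : (size (trials V k) <= ntrial D k * nkeep D k)%N.
Proof.
rewrite (perm_size (perm_trials V k)) size_flatten /shape -map_comp sumnE big_map.
apply: (@leq_trans (\sum_(t <- enum 'I_(ntrial D k)) nkeep D k)).
  by apply: leq_sum => t _; apply: size_ttrial.
by rewrite big_const_seq count_predT iter_addn_0 mulnC size_enum_ord.
Qed.

(** Each selected position uses up 9 T / 10 of the at most T [nkeep] retained estimates. This limits
    the number of columns to be subtracted. *)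
Lemma size_tpass V (k : 'I_(npass D)) : (0 < ntrial D k)%N ->
  (9 * size (tpass V k).1 <= 10 * nkeep D k)%N.
Proof.
move=> T0; have [K [uK KE] ->] := tpass_val V k; rewrite size_map.
set K' := filter _ _; have uK' : uniq K' by apply: filter_uniq.
have sum_est : (\sum_(j <- K') size (estimates V k j) <= size (trials V k))%N.
  have [_ sp] := tsort_val (trials V k) (@by_position_value_total R D).
  rewrite -(perm_size sp) /estimates; set s := (tsort _ _).1.
  rewrite (eq_bigr (fun j => \sum_(e <- s) (e.1 == j))%N); last first.
    move=> j _; rewrite size_map size_filter -sum1_count big_mkcond.
    by apply: eq_bigr => e _; case: eqP.
  rewrite exchange_big -sum1_size /=; apply: leq_sum => e _.
  rewrite (eq_bigr (fun j => pred1 e.1 j : nat)); last by move=> j _; rewrite /= eq_sym.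
  by rewrite -big_mkcond sum1_count count_uniq_mem // leq_b1.
have : (\sum_(j <- K') 9 * ntrial D k <= \sum_(j <- K') 10 * size (estimates V k j))%N.
  by rewrite big_seq [X in (_ <= X)%N]big_seq; apply: leq_sum => j; rewrite mem_filter => /andP[].
rewrite -!big_distrr /= big_const_seq count_predT iter_addn_0.
have := size_trials V k; move: sum_est T0.
move: (size (trials V k)) (size K') (ntrial D k) (nkeep D k) (\sum_(_ <- _) _)%N => a x t n y.
move=> h1 h2 h3 h4; rewrite -(leq_pmul2l h2) mulnCA; apply: leq_trans h4 _.
by rewrite mulnCA leq_mul2l (leq_trans h1).
Qed.
End PassSpec.

(** * The implementation of the whole algorithm *)

Section RunSpec.
Variables (R : realType) (D : design) (w : sample D).
Notation d := (dim D).
Notation sketch := ('cV[R]_(nsketch D)).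
Implicit Types (V : sketch) (b : block D) (e : 'I_d * R).

Lemma entry_inj (al al' : arow D) i i' : entry al i = entry al' i' -> al = al' /\ i = i'.
Proof. by move=> /cast_ord_inj /enum_rank_inj [/enum_rank_inj]. Qed.

Lemma foldl_sub (U : zmodType) (I : Type) (F : I -> U) u s :
  foldl (fun u i => u - F i) u s = u - \sum_(i <- s) F i.
Proof.
elim: s u => [|i s IH] u /=; first by rewrite big_nil subr0.
by rewrite IH big_cons opprD addrA.
Qed.

Lemma foldl_add (U : zmodType) (u : U) s :
  foldl (fun x y => x + y) u s = u + \sum_(x <- s) x.
Proof.
elim: s u => [|x s IH] u /=; first by rewrite big_nil addr0.
by rewrite IH big_cons addrA.
Qed.

Definition bit (i : 'I_(nbits D).+1) (j : 'I_d) : bool :=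
  if unlift ord0 i is Some i' then digit j i' else true.

Lemma vector_of1 e j : vector_of [:: e] j 0 = if e.1 == j then e.2 else 0.
Proof. by rewrite mxE big_cons big_nil addr0. Qed.

Lemma vector_of_cons e es :
  vector_of (e :: es) = vector_of es + vector_of [:: e] :> 'cV[R]_d.
Proof.
apply/colP => j; rewrite [RHS]mxE vector_of1 !mxE big_cons.
by case: ifP => _; rewrite ?addr0 // addrC.
Qed.

Lemma vector_of_cat es es' :
  vector_of (es ++ es') = vector_of es + vector_of es' :> 'cV[R]_d.
Proof. by apply/colP => j; rewrite !mxE big_cat. Qed.

Lemma tsubtract_val V e : (tsubtract w V e).1 = V - Phi R w *m vector_of [:: e].
Proof.
(* The effect of a single write. The fold becomes a sum of these, and by [entry_inj] each cell of
   the sketch receives at most one of them. *)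
pose F b i : sketch := ((bit i e.1)%:R * e.2) *: delta_mx (entry (mkrow (w b e.1)) i) 0.
have -> : (tsubtract w V e).1 = V - \sum_(b <- enum (block D)) \sum_(i <- enum 'I_(nbits D).+1) F b i.
  rewrite -foldl_sub /tsubtract tfold_val; elim: (enum (block D)) V => //= b bs IH V.
  rewrite {}IH; congr (foldl _ _ _); rewrite -foldl_sub tfold_val.
  elim: (enum _) V => //= i l IH V; rewrite {}IH; congr (foldl _ _ _).
  rewrite /F /bit; case: ifP => _ /=; last by rewrite mul0r scale0r subr0.
  apply/colP => z; rewrite !mxE andbT mul1r.
  by case: eqP => [->|_]; rewrite ?mulr1 ?mulr0 ?subr0.
congr (_ - _); apply/colP => z; rewrite big_enum /=.
case/mxvec_indexP: z => p i; rewrite -(enum_valK p); case: (enum_val p) => b n.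
rewrite -[mxvec_index _ _]/(entry (@mkrow D b n) i).
rewrite summxE (bigD1 b) //= big_enum summxE (bigD1 i) //= [X in _ + X]big1 ?addr0; last first.
  move=> b' bb; rewrite summxE big1 // => i' _; rewrite !mxE.
  case: eqP => [/entry_inj[/(congr1 (@projT1 _ _)) /= eb _]|_]; last by rewrite /= mulr0.
  by rewrite eb eqxx in bb.
rewrite [X in _ + X]big1 ?addr0; last first.
  move=> i' ii; rewrite !mxE; case: eqP => [/entry_inj[_ ei]|_]; last by rewrite /= mulr0.
  by rewrite ei eqxx in ii.
rewrite [RHS]mxE (bigD1 e.1) //= [X in _ + X]big1 ?addr0; last first.
  by move=> j je; rewrite vector_of1 eq_sym (negbTE je) mulr0.
have eE : (entry (@mkrow D b n) i == entry (mkrow (w b e.1)) i) = (w b e.1 == n).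
  apply/eqP/eqP => [/entry_inj[/eqP E _]|<- //].
  by move: E; rewrite /mkrow -tag_eqE /tag_eq eqxx /= tagged_asE => /eqP.
rewrite vector_of1 eqxx Phi_entry !mxE eE eqxx andbT [LHS]mulrC mulrA.
by congr (_ * _ * _); rewrite /bit; case: (unlift ord0 i).
Qed.

Lemma foldl_tsubtract V es :
  foldl (fun V e => (tsubtract w V e).1) V es = V - Phi R w *m vector_of es.
Proof.
elim: es V => [|e es IH] V /=.
  rewrite (_ : vector_of _ = 0) ?mulmx0 ?subr0 //.
  by apply/colP => j; rewrite !mxE big_nil.
by rewrite IH tsubtract_val (vector_of_cons e es) mulmxDr opprD addrA addrAC.
Qed.

Definition run_pass (Vh : sketch * spikes R D) (k : 'I_(npass D)) : timed (sketch * spikes R D) :=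
  bind (tpass Vh.1 k) (fun ft =>
  bind (tfold (tsubtract w) Vh.1 ft) (fun V' =>
  charge (size ft).+1 (V', ft ++ Vh.2))).

Definition run_state V0 n : sketch * spikes R D :=
  foldl (fun Vh k => (run_pass Vh k).1) (V0, [::]) (take n (enum 'I_(npass D))).

Lemma run_stateS V0 (k : 'I_(npass D)) :
  run_state V0 k.+1 = (run_pass (run_state V0 k) k).1.
Proof.
rewrite /run_state (take_nth k) ?size_enum_ord // foldl_rcons.
by rewrite nth_ord_enum.
Qed.

Lemma run_pass_val Vh k : (run_pass Vh k).1 =
  (Vh.1 - Phi R w *m vector_of (tpass Vh.1 k).1, (tpass Vh.1 k).1 ++ Vh.2).
Proof. by rewrite /run_pass 2!bind_val tfold_val foldl_tsubtract. Qed.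

Lemma run_state_residual V0 n :
  (run_state V0 n).1 = V0 - Phi R w *m vector_of (run_state V0 n).2.
Proof.
rewrite /run_state; elim/last_ind: (take n _) => [|s k IH].
  rewrite /= (_ : vector_of _ = 0) ?mulmx0 ?subr0 //.
  by apply/colP => j; rewrite !mxE big_nil.
rewrite foldl_rcons run_pass_val; move: (foldl _ _ _) IH => st IH.
move: (tpass _ _).1 => ft; rewrite /= IH vector_of_cat mulmxDr opprD addrA.
by rewrite addrAC.
Qed.

Definition sum_group (g : 'I_d * seq R) : timed ('I_d * R) :=
  bind (tfold (fun x y => step (x + y)) 0 g.2) (fun x => step (g.1, x)).

Definition final_spikes (es : spikes R D) : timed (spikes R D) :=
  bind (tsort (@by_position_value R D) es) (fun es =>
  bind (runs es) (fun gs =>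
  bind (tmap sum_group gs) (fun es =>
  bind (tsort (@by_magnitude R D) es) (fun es =>
  ttake (sparsity D) es)))).

Lemma run_chaining_pursuitE V : run_chaining_pursuit w V =
  bind (tfold run_pass (V, [::]) (enum 'I_(npass D))) (fun Vh => final_spikes Vh.2).
Proof. by []. Qed.

Lemma superset_card (T : finType) (A : {set T}) n : (#|A| <= n <= #|T|)%N ->
  exists2 B : {set T}, A \subset B & #|B| = n.
Proof.
case/andP=> An nT; pose C := [set x in take (n - #|A|) (enum (~: A))].
have cC : #|C| = (n - #|A|)%N.
  rewrite cardsE (card_uniqP _) ?take_uniq ?enum_uniq // size_takel // -cardE.
  by rewrite -(leq_add2l #|A|) cardsC; lia.
exists (A :|: C); first exact: subsetUl.
rewrite cardsU cC (_ : A :&: C = set0) ?cards0; first lia.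
apply/setP => x; rewrite !inE; apply/negP => /andP[xA /mem_take].
by rewrite mem_enum inE xA.
Qed.

(** Positions that are not stored have total 0. If fewer than m are stored, the set of kept
    positions is filled up with such positions to the size required by [largest]. *)
Lemma best_approx_final es :
  best_approx (sparsity D) (vector_of es) (vector_of (final_spikes es).1 : 'cV[R]_d).
Proof.
pose h j : R := vector_of es j 0; set m := sparsity D.
pose s := (tsort (@by_position_value R D) es).1.
pose s3 := (tsort (@by_magnitude R D) [seq (sum_group g).1 | g <- (runs s).1]).1.
have fE : (final_spikes es).1 = take m s3.
  rewrite /final_spikes 4!bind_val /s3; congr (take _ (tsort _ _).1).
  by rewrite tmap_val.
have [ss sp] := tsort_val es (@by_position_value_total R D); rewrite -/s in ss sp.
have [s3s s3p] := tsort_val [seq (sum_group g).1 | g <- (runs s).1] (@by_magnitude_total R D).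
rewrite -/s3 in s3s s3p.
have [gU gE] := runs_val (@position_le_trans D) (@position_le_anti D)
  (sub_sorted (@sub_by_position_value R D) ss).
set K := [seq g.1 | g <- (runs s).1] in gU gE.
have sumE : [seq (sum_group g).1 | g <- (runs s).1] = [seq (j, h j) | j <- K].
  rewrite gE -map_comp; apply: eq_map => j /=.
  rewrite tfold_val /h mxE /= -(perm_big _ sp) -big_filter -(big_map (fun e => e.2) xpredT id).
  move: [seq e.2 | e <- _] => xs; congr (_, _).
  exact: etrans (foldl_add 0 xs) (add0r _).
rewrite sumE in s3p.
have KE : [seq e.1 | e <- [seq (j, h j) | j <- K]] = K by rewrite -map_comp map_id.
have U3 : uniq [seq e.1 | e <- s3] by rewrite (perm_uniq (perm_map _ s3p)) KE.
have h3 : {in s3, forall e, e.2 = h e.1}.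
  by move=> e; rewrite (perm_mem s3p) => /mapP[j _ ->].
pose E := [set j in K].
have mem3 : [seq e.1 | e <- s3] =i E.
  by move=> j; rewrite (perm_mem (perm_map _ s3p)) KE inE.
have h0 j : j \notin E -> h j = 0.
  rewrite inE runs_keys (perm_mem (perm_map _ sp)) => jes.
  rewrite /h mxE big_seq_cond big1 // => e /andP[ees /eqP ej].
  by case/negP: jes; rewrite -ej; apply: map_f.
have [Q0E cQ0 top] := largest_take m s3s U3 mem3 h3.
set Q0 := [set j in _] in Q0E cQ0 top.
have tE j : vector_of (take m s3) j 0 = if j \in Q0 then h j else 0.
  have -> : take m s3 = [seq (j, h j) | j <- [seq e.1 | e <- take m s3]].
    rewrite -map_comp -[LHS]map_id; apply/eq_in_map => e et /=.
    by rewrite -h3 ?(mem_take et) // -surjective_pairing.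
  by rewrite vector_of_map ?map_take ?take_uniq // inE -map_take.
have Ed : (#|E| <= d)%N by rewrite -[X in (_ <= X)%N]card_ord max_card.
have [Q Q0Q cQ] : exists2 Q : {set 'I_d}, Q0 \subset Q & #|Q| = minn m d.
  apply: superset_card; rewrite card_ord geq_minr andbT cQ0 leq_min geq_minl /=.
  exact: leq_trans (geq_minr _ _) Ed.
(* A stored position outside [Q0] shows that the list was truncated at m, so nothing was filled
   up. *)
have QQ0 j : j \in E -> j \notin Q0 -> Q0 = Q.
  move=> jE jQ0; have : (#|Q0| < #|E|)%N.
    by apply/proper_card/properP; split=> //; exists j.
  rewrite cQ0 gtn_min ltnn orbF => mE; apply/eqP.
  by rewrite eqEcard Q0Q cQ cQ0 (minn_idPl (ltnW mE)) geq_minl.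
exists Q.
  split; rewrite ?subsetT // ?cardsT ?card_ord // => i j iQ /setDP[_ jQ].
  have [jE|jE] := boolP (j \in E); last by rewrite -/(h j) h0 // normr0.
  have jQ0 : j \notin Q0 by apply: contra jQ; apply: (subsetP Q0Q).
  by apply: top; rewrite (QQ0 j) // inE jQ.
move=> j; rewrite fE tE; case: (boolP (j \in Q0)) => [jQ0|jQ0].
  by rewrite (subsetP Q0Q).
case: ifP => // jQ; rewrite -/(h j) h0 //; apply/negP => jE.
by case/negP: (jQ0); rewrite (QQ0 j jE jQ0).
Qed.

Lemma run_chaining_pursuit_correct (f : 'cV[R]_d) :
    (forall k : 'I_(npass D), 0 < ntrial D k)%N ->
  chaining_pursuit (Phi R w) (Phi R w *m f)
    (vector_of (run_chaining_pursuit w (Phi R w *m f)).1).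
Proof.
move=> T0; pose V := Phi R w *m f; exists (fun n => vector_of (run_state V n).2); split.
- by rewrite /run_state take0 /=; apply/colP => j; rewrite !mxE big_nil.
- move=> k; have := pass_tpass (run_state V k).1 (T0 k).
  by rewrite run_stateS run_pass_val /= vector_of_cat addrK -run_state_residual.
have := best_approx_final (run_state V (npass D)).2.
rewrite run_chaining_pursuitE bind_val tfold_val /run_state take_oversize //.
by rewrite size_enum_ord.
Qed.
End RunSpec.

(** * Running time *)

Section Time.
Variables (R : realType) (D : design) (w : sample D).
Notation d := (dim D).
Notation L := (nbits D).
Notation sketch := ('cV[R]_(nsketch D)).
Implicit Types (V : sketch) (b : block D) (e : 'I_d * R).
Local Open Scope nat_scope.

Lemma tdecode_time V (al : arow D) : (tdecode V al).2 <= 3 * L + 3.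
Proof.
rewrite /tdecode bind_time bind_time /=.
have : (tfold (fun (p : nat) (i : 'I_L) =>
             bind (tread V al (lift ord0 i)) (fun x =>
             step (p.*2 + decoded_bit (V (entry al ord0) 0%R) x)))
          0 (rev (enum 'I_L))).2 <= size (rev (enum 'I_L)) * 3 + 1 by apply: tfold_time.
rewrite size_rev size_enum_ord; move: (tfold _ _ _).2 => a; lia.
Qed.

Lemma ttrial_arith (r l j n a1 a2 a4 a5 a6 e g : nat) :
    a1 <= (3 * l + 3).+2 * r + 1 -> a2 <= j.+1 * (5 * r) -> a4 <= g * 2 + 1 ->
    a5 <= j.+1 * (5 * r) -> a6 <= n.+1 -> g <= e -> e <= r -> 0 < r ->
  a1 + (a2 + (e + 1 + (a4 + (a5 + a6)))) <= r * (3 * l + 10 * j + 25) + n.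
Proof. nia. Qed.

Lemma ttrial_time V b j : npart D (tag b) <= 2 ^ j -> 0 < npart D (tag b) ->
  (ttrial V b).2 <= npart D (tag b) * (3 * L + 10 * j + 25) + nkeep D (tag b).
Proof.
set r := npart D (tag b) => rj r0.
pose es := (tpmap (fun n => tdecode V (mkrow (b := b) n)) (enum 'I_r)).1.
pose s1 := (tsort (@by_position_magnitude R D) es).1.
pose f (g : 'I_d * seq R) := step (g.1, head 0%R g.2).
pose s2 := (tmap f (runs s1).1).1.
have -> : (ttrial V b).2 =
    (tpmap (fun n => tdecode V (mkrow (b := b) n)) (enum 'I_r)).2 +
    ((tsort (@by_position_magnitude R D) es).2 + ((runs s1).2 +
    ((tmap f (runs s1).1).2 + ((tsort (@by_magnitude R D) s2).2 +
     (ttake (nkeep D (tag b)) (tsort (@by_magnitude R D) s2).1).2)))) by [].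
have es_r : size es <= r.
  by rewrite /es tpmap_val size_pmap (leq_trans (count_size _ _)) ?size_enum_ord.
have s1E : size s1 = size es.
  exact: perm_size (tsort_val es (@by_position_magnitude_total R D)).2.
have s2E : size s2 <= r.
  by rewrite /s2 tmap_val size_map (leq_trans (runs_size_le _)) // s1E.
have h1 := tpmap_time_sum (enum 'I_r) (fun n => tdecode_time V (mkrow (b := b) n)).
rewrite big_const_seq count_predT iter_addn_0 size_enum_ord in h1.
have h2 := tsort_time (@by_position_magnitude R D) (leq_trans es_r rj).
have h3 := runs_time s1.
have h4 := tmap_time (runs s1).1 (fun g => leqnn (f g).2 : (f g).2 <= 1).
have h5 := tsort_time (@by_magnitude R D) (leq_trans s2E rj).
have h6 := ttake_time (nkeep D (tag b)) (tsort (@by_magnitude R D) s2).1.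
have h7 := runs_size_le s1.
have h8 : j.+1 * (3 * size es + 2) <= j.+1 * (5 * r) by rewrite leq_mul2l; lia.
have h9 : j.+1 * (3 * size s2 + 2) <= j.+1 * (5 * r) by rewrite leq_mul2l; lia.
rewrite h3 s1E; rewrite s1E in h7.
exact: ttrial_arith h1 (leq_trans h2 h8) h4 (leq_trans h5 h9) h6 h7 es_r r0.
Qed.

Lemma tpass_arith (A B c a1 a2 a4 s : nat) :
    a1 <= A + 1 -> a2 <= B -> a4 <= 6 * s + 1 -> s <= c ->
  a1 + (a2 + (s + 1 + a4)) <= A + B + 7 * c + 3.
Proof. lia. Qed.

Lemma tpass_time V (k : 'I_(npass D)) j j' : npart D k <= 2 ^ j -> 0 < npart D k ->
    ntrial D k * nkeep D k <= 2 ^ j' ->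
  (tpass V k).2 <=
    ntrial D k * (npart D k * (3 * L + 10 * j + 25) + 2 * nkeep D k + 2) +
    j'.+1 * (3 * (ntrial D k * nkeep D k) + 2) + 7 * (ntrial D k * nkeep D k) + 3.
Proof.
set T := ntrial D k; set n := nkeep D k; set r := npart D k => rj r0 Tnj.
rewrite tpassE bind_time; set es := (tfold _ _ _).1.
rewrite bind_time; set s := (tsort _ _).1; rewrite bind_time.
have esT : size es <= T * n by rewrite /es tfold_val; apply: size_trials.
have sE : size s = size es.
  exact: perm_size (tsort_val es (@by_position_value_total R D)).2.
have h1 : (tfold (@add_trial R D V k) [::] (enum 'I_T)).2 <=
    T * (r * (3 * L + 10 * j + 25) + 2 * n + 2) + 1.
  have := @tfold_time _ _ (@add_trial R D V k) (r * (3 * L + 10 * j + 25) + 2 * n + 1) [::] (enum 'I_T).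
  rewrite size_enum_ord -addnS; apply=> acc t; rewrite /add_trial bind_time [(charge _ _).2]/=.
  have t1 : (ttrial V (mkblock t)).2 <= r * (3 * L + 10 * j + 25) + n.
    exact: (@ttrial_time V (mkblock t) j rj r0).
  have t2 : size (ttrial V (mkblock t)).1 <= n by exact: (size_ttrial V (mkblock t)).
  rewrite -ltnS in t2; apply: leq_trans (leq_add t1 t2) _; lia.
have h2 := tsort_time (@by_position_value R D) (leq_trans esT Tnj).
have h3 := runs_time s.
have h4 : (tpmap (@select R D k) (runs s).1).2 <= 6 * size s + 1.
  have := @tpmap_time_sum _ _ (@select R D k) (fun g => 2 * size g.2 + 2) (runs s).1.
  move=> /(_ _)/leq_trans; apply.
    by move=> g; rewrite /select bind_time /=; case: ifP => _ /=; lia.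
  rewrite addn1 addn1 ltnS.
  rewrite (eq_bigr (fun g => 2 * size g.2 + 4)); last by move=> g _ /=; lia.
  rewrite big_split /= -big_distrr /= -(big_map (fun g => size g.2) xpredT id) -sumnE runs_size.
  rewrite big_const_seq count_predT iter_addn_0.
  by rewrite (_ : 6 = 2 + 4) // mulnDl leq_add2l leq_mul2l runs_size_le.
have h5 : j'.+1 * (3 * size es + 2) <= j'.+1 * (3 * (T * n) + 2).
  by rewrite leq_mul2l leq_add2r leq_mul2l esT !orbT.
have h6 := leq_trans h2 h5.
rewrite h3; rewrite sE in h4 *.
exact: tpass_arith h1 h6 h4 esT.
Qed.

Lemma tsubtract_time V e : (tsubtract w V e).2 <= #|block D| * (4 * L + 7) + 1.
Proof.
rewrite [#|block D|]cardE.
apply: leq_trans (@tfold_time _ _ _ (4 * L + 6) V (enum (block D)) _) _; last first.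
  by rewrite leq_add2r leq_mul2l -addnS leqnn orbT.
move=> V' b; rewrite bind_time [(step _).2]/=.
apply: leq_trans (leq_add (leqnn 1) (@tfold_time _ _ _ 3 V' (enum 'I_L.+1) _)) _; last first.
  by rewrite size_enum_ord; lia.
by move=> V'' i; rewrite bind_time; case: ifP.
Qed.

(** [j] and [j'] bound the binary logarithms of the lengths of the lists sorted in a trial and at
    the end of the pass. The last product is the subtraction of at most 2 n spikes from all
    blocks. *)
Definition pass_cost (T r n j j' : nat) : nat :=
  T * (r * (3 * L + 10 * j + 25) + 2 * n + 2) + j'.+1 * (3 * (T * n) + 2) + 7 * (T * n) +
  2 * n * (#|block D| * (4 * L + 7) + 3) + 5.

Lemma run_pass_time (Vh : sketch * spikes R D) (k : 'I_(npass D)) j j' :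
    npart D k <= 2 ^ j -> 0 < npart D k ->
    ntrial D k * nkeep D k <= 2 ^ j' -> 0 < ntrial D k ->
  (run_pass w Vh k).2 <= pass_cost (ntrial D k) (npart D k) (nkeep D k) j j'.
Proof.
move=> rj r0 Tn T0; rewrite /run_pass 2!bind_time.
have h1 := tpass_time Vh.1 rj r0 Tn; have h2 := size_tpass Vh.1 T0.
set ft := (tpass Vh.1 k).1 in h2 *.
have h3 := tfold_time Vh.1 ft (tsubtract_time : forall V e, _).
have h4 : size ft <= 2 * nkeep D k by lia.
have h5 : size ft * (#|block D| * (4 * L + 7) + 1).+1 <=
    2 * nkeep D k * (#|block D| * (4 * L + 7) + 1).+1.
  by rewrite leq_mul2r h4 orbT.
rewrite /pass_cost.
have arith (a b s A B C E n : nat) :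
    a <= A + B + C + 3 -> b <= s * E.+1 + 1 -> s <= 2 * n -> s * E.+1 <= 2 * n * E.+1 ->
  a + (b + s.+1) <= A + B + C + 2 * n * (E + 2) + 5 by nia.
apply: leq_trans (arith _ _ _ _ _ _ _ _ h1 h3 h4 h5) _.
by rewrite -[X in 2 * _ * X]addnA.
Qed.

Lemma final_spikes_time (es : spikes R D) j : size es <= 2 ^ j ->
  (final_spikes es).2 <= j.+1 * (6 * size es + 4) + 8 * size es + sparsity D + 5.
Proof.
move=> esj; rewrite /final_spikes bind_time; set s := (tsort _ _).1.
rewrite bind_time bind_time; set s2 := (tmap _ _).1; rewrite bind_time.
have sE : size s = size es.
  exact: perm_size (tsort_val es (@by_position_value_total R D)).2.
have s2E : size s2 <= size es.
  by rewrite /s2 tmap_val size_map (leq_trans (runs_size_le _)) // sE.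
have h1 := tsort_time (@by_position_value R D) esj.
have h2 := runs_time s.
have h3 : (tmap (@sum_group R D) (runs s).1).2 <= 5 * size es + 1.
  have := @tmap_time_sum _ _ (@sum_group R D) (fun g => 2 * size g.2 + 2) (runs s).1.
  move=> /(_ _)/leq_trans; apply.
    move=> g; rewrite /sum_group bind_time [(step _).2]/=.
    have := @tfold_time _ _ (fun x y : R => step (x + y)%R) 1 0%R g.2 (fun _ _ => leqnn _).
    move: (tfold _ _ _).2 => a; lia.
  rewrite addn1 addn1 ltnS.
  rewrite (eq_bigr (fun g => 2 * size g.2 + 3)); last by move=> g _ /=; lia.
  rewrite big_split /= -big_distrr /= -(big_map (fun g => size g.2) xpredT id) -sumnE runs_size.
  rewrite big_const_seq count_predT iter_addn_0.
  by rewrite -sE (_ : 5 = 2 + 3) // mulnDl leq_add2l leq_mul2l runs_size_le.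
have h4 := tsort_time (@by_magnitude R D) (leq_trans s2E esj).
have h5 := ttake_time (sparsity D) (tsort (@by_magnitude R D) s2).1.
have h6 : j.+1 * (3 * size s2 + 2) <= j.+1 * (3 * size es + 2).
  by rewrite leq_mul2l leq_add2r leq_mul2l s2E !orbT.
rewrite h2 sE.
have arith (a1 a3 a4 a5 J s0 m : nat) : a1 <= J -> a3 <= 5 * s0 + 1 -> a4 <= J ->
  a5 <= m.+1 -> a1 + (s0 + 1 + (a3 + (a4 + a5))) <= 2 * J + 8 * s0 + m + 5 by lia.
have := arith _ _ _ _ _ _ _ h1 h3 (leq_trans h4 h6) h5.
by rewrite mulnCA mulnDr mulnA.
Qed.

Lemma run_chaining_pursuit_time V (u : nat) (B : 'I_(npass D) -> nat) j :
    (forall (Vh : sketch * spikes R D) k, (run_pass w Vh k).2 <= B k) ->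
    (forall k : 'I_(npass D), 0 < ntrial D k) ->
    \sum_(k < npass D) 2 * nkeep D k <= u -> u <= 2 ^ j ->
  (run_chaining_pursuit w V).2 <=
    \sum_(k < npass D) (B k).+1 + j.+1 * (6 * u + 4) + 8 * u + sparsity D + 6.
Proof.
move=> Bk T0 nu uj; rewrite run_chaining_pursuitE bind_time.
set es := (tfold _ _ _).1.2.
have es_u : size es <= u.
  apply: leq_trans nu; rewrite /es tfold_val -big_enum /=.
  suff H s (acc : sketch * spikes R D) : size (foldl (fun Vh k => (run_pass w Vh k).1) acc s).2 <=
      \sum_(k <- s) 2 * nkeep D k + size acc.2.
    by have := H (enum 'I_(npass D)) (V, [::]); rewrite addn0.
  elim: s acc => [|k s IH] acc; first by rewrite big_nil.
  apply: leq_trans (IH (run_pass w acc k).1) _.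
  have -> : (run_pass w acc k).1.2 = (tpass acc.1 k).1 ++ acc.2 by rewrite run_pass_val.
  rewrite big_cons size_cat addnA leq_add2r addnC leq_add2r.
  by have := size_tpass acc.1 (T0 k); move: (size _) (nkeep D k) => a b; lia.
have h1 := tfold_time_sum (V, [::]) (enum 'I_(npass D)) Bk; rewrite big_enum in h1.
have h2 := final_spikes_time (leq_trans es_u uj).
have h3 : j.+1 * (6 * size es + 4) <= j.+1 * (6 * u + 4).
  by rewrite leq_mul2l leq_add2r leq_mul2l es_u !orbT.
have arith (a b S1 J1 J2 s0 m : nat) : a <= S1 + 1 -> b <= J1 + 8 * s0 + m + 5 ->
  J1 <= J2 -> s0 <= u -> a + b <= S1 + J2 + 8 * u + m + 6 by lia.
exact: arith h1 h2 h3 es_u.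
Qed.
End Time.

(** * Numerical bounds for size and time *)

Section Bounds.
Variable R : realType.

(** 12 is the value of the infinite series. This sum is why all passes together cost only a constant
    times m and logarithms: m / 2^k decays faster than the square of T_k grows. *)
Lemma sum_sqr_geom n :
  \sum_(k < n) k.+1%:R ^+ 2 / 2 ^+ k <= 12 :> R.
Proof.
suff -> : \sum_(k < n) k.+1%:R ^+ 2 / 2 ^+ k =
    12 - (2 * n%:R ^+ 2 + 8 * n%:R + 12) / 2 ^+ n :> R.
  by rewrite gerBl divr_ge0 ?exprn_ge0 // !addr_ge0 ?mulr_ge0 ?exprn_ge0.
elim: n => [|n IHn]; first by rewrite big_ord0 expr0; lra.
rewrite big_ord_recr IHn /= [2 ^+ n.+1]exprS -natr1; field.
by rewrite expf_neq0 // pnatr_eq0.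
Qed.

Lemma up_log_le n : (0 < n)%N -> (up_log 2 n)%:R <= 1 + 3 * ln (n%:R : R).
Proof.
move=> n0; have [n1|n1] := leqP n 1.
  have -> : n = 1%N by apply/eqP; rewrite eqn_leq n1.
  by rewrite ln1 mulr0 addr0 up_log1 ler01.
have /andP[lt _] := up_log_bounds (isT : 1 < 2)%N n1.
have u0 : (0 < up_log 2 n)%N by rewrite up_log_gt0.
have ln2 := @ln_ge_third R 2 isT.
have : ln ((2 ^ (up_log 2 n).-1)%:R : R) <= ln n%:R.
  by rewrite ler_ln ?posrE ?ltr0n ?expn_gt0 // ler_nat ltnW.
rewrite natrX lnXn ?ltr0n // -[ln 2 *+ _]mulr_natr -subn1 natrB // => h.
have k0 : 0 <= (up_log 2 n)%:R - 1 :> R by rewrite subr_ge0 ler1n.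
nra.
Qed.

(** It is applied with G = (k + 1) (1 + ln m) ln d and y = m / 2^k. Each term is at most a constant
    times y G^2; 1 <= y and 1 <= 3 G absorb the additive constants. *)
Lemma pass_cost_arith (t r n l j U b y G ct cr p : R) :
    0 <= t -> 0 <= r -> 0 <= n -> 0 <= l -> 0 <= j -> 0 <= U -> 0 <= b ->
    0 <= ct -> 0 <= cr -> 0 <= p ->
    t <= ct * G -> r <= cr * y -> n <= y -> l <= 6 * G -> U <= 9 * G ->
    j = p + U -> b * (4 * l + 7) <= 45 * ct * G ^+ 2 -> 1 <= y -> 1 <= 3 * G ->
  t * (r * (3 * l + 10 * j + 25) + 2 * n + 2) + (t + U + 1) * (3 * (t * n) + 2) +
    7 * (t * n) + 2 * n * (b * (4 * l + 7) + 3) + 6 <=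
  (ct * (cr * (183 + 30 * p) + 12) + (ct + 12) * (3 * ct + 6) + 21 * ct + 90 * ct + 108) *
    (y * G ^+ 2).
Proof.
move=> t0 r0 n0 l0 j0 U0 b0 ct0 cr0 p0 tG ry ny lG UG jE bG y1 G1.
have y0 : 0 <= y by lra.
have G0 : 0 <= G by lra.
have yG : 0 <= y * G by rewrite mulr_ge0.
have GG : 0 <= G ^+ 2 by rewrite exprn_ge0.
have G2 : G <= 3 * G ^+ 2 by nra.
have a1 : 3 * l + 10 * j + 25 <= (183 + 30 * p) * G.
  have : p <= 3 * p * G by nra.
  lra.
have a2 : r * (3 * l + 10 * j + 25) <= cr * y * ((183 + 30 * p) * G).
  by apply: ler_pM => //; lra.
have ynG : y <= 3 * (y * G) by nra.
have a3 : r * (3 * l + 10 * j + 25) + 2 * n + 2 <= (cr * (183 + 30 * p) + 12) * (y * G) by lra.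
have a3' : 0 <= r * (3 * l + 10 * j + 25) + 2 * n + 2.
  by rewrite !addr_ge0 // mulr_ge0 // !addr_ge0 // mulr_ge0.
have a4 := ler_pM t0 a3' tG a3.
have a5 : t * n <= ct * G * y by apply: ler_pM.
have tn0 : 0 <= t * n by rewrite mulr_ge0.
have a6 : t + U + 1 <= (ct + 12) * G by lra.
have a7 : 3 * (t * n) + 2 <= (3 * ct + 6) * (y * G) by lra.
have a8 : (t + U + 1) * (3 * (t * n) + 2) <= (ct + 12) * G * ((3 * ct + 6) * (y * G)).
  by apply: ler_pM => //; lra.
have yGG : y * G <= 3 * (y * G ^+ 2) by nra.
have a9 : 7 * (t * n) <= 21 * ct * (y * G ^+ 2).
  have := ler_wpM2l ct0 yGG; lra.
have b4 : 0 <= b * (4 * l + 7) by rewrite mulr_ge0 // addr_ge0 // mulr_ge0.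
have a10 : n * (b * (4 * l + 7) + 3) <= y * (45 * ct * G ^+ 2 + 27 * G ^+ 2).
  by apply: ler_pM => //; lra.
have a11 : 6 <= 54 * (y * G ^+ 2) by lra.
have -> : (ct * (cr * (183 + 30 * p) + 12) + (ct + 12) * (3 * ct + 6) + 21 * ct + 90 * ct + 108) *
    (y * G ^+ 2) = ct * G * ((cr * (183 + 30 * p) + 12) * (y * G)) +
    (ct + 12) * G * ((3 * ct + 6) * (y * G)) + 21 * ct * (y * G ^+ 2) +
    2 * (y * (45 * ct * G ^+ 2 + 27 * G ^+ 2)) + 54 * (y * G ^+ 2) by ring.
lra.
Qed.

End Bounds.

(** * Sketch size and running time for the chosen design *)

Section Resources.
Variable R : realType.

Lemma natr_pass_cost (D : design) T r n j j' :
  (pass_cost D T r n j j').+1%:R =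
  T%:R * (r%:R * (3 * (nbits D)%:R + 10 * j%:R + 25) + 2 * n%:R + 2) +
    (j'%:R + 1) * (3 * (T%:R * n%:R) + 2) + 7 * (T%:R * n%:R) +
    2 * n%:R * (#|block D|%:R * (4 * (nbits D)%:R + 7) + 3) + 6 :> R.
Proof.
by rewrite /pass_cost -addn1 -[j'.+1]addn1 !(natrD, natrM); ring.
Qed.

Variables (c1 c2 : R) (d m : nat).
Hypotheses (d_ge2 : (2 <= d)%N) (m_ge1 : (1 <= m)%N) (c1_gt0 : 0 < c1) (c2_gt0 : 0 < c2).
Notation D := (chaining_design 8 c1 c2 d m).
Notation l := (ln (d%:R : R)).
Notation M := (1 + ln (m%:R : R)).

Lemma ntrial_le k : (ntrial D k)%:R <= (c1 + 3) * (k.+1%:R * l).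
Proof.
have /andP[_ h] := ntrial_itv c2 m d_ge2 c1_gt0 k.
have k1 : 1 <= k.+1%:R :> R by rewrite ler1n.
have := ln_ge_third R d_ge2; nra.
Qed.

Lemma halving_ge1 k : (k < npass D)%N -> 1 <= m%:R / 2 ^+ k :> R.
Proof.
move=> /(level_ge1 m_ge1) h; apply: le_trans h _.
rewrite ler_wpM2l // lef_pV2 ?posrE ?exprn_gt0 // lerXn2r ?nnegrE //; lra.
Qed.

Lemma nkeep_le k : (nkeep D k)%:R <= m%:R / 2 ^+ k :> R.
Proof.
have /andP[h _] := nkeep_itv c1 c2 d m_ge1 k; apply: le_trans h _.
rewrite ler_wpM2l // lef_pV2 ?posrE ?exprn_gt0 // lerXn2r ?nnegrE //; lra.
Qed.

Lemma npart_le k : (k < npass D)%N -> (npart D k)%:R <= (c2 + 1) * (m%:R / 2 ^+ k).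
Proof.
move=> /halving_ge1 h; have /andP[_ ] := npart_itv c1 d m c2_gt0 k; lra.
Qed.

Lemma nbits_le : (nbits D)%:R <= 6 * l.
Proof.
have := up_log_le R (ltnW d_ge2); have := ln_ge_third R d_ge2.
rewrite /nbits /=; lra.
Qed.

Lemma card_block : #|block D| = (\sum_(k < npass D) ntrial D k)%N.
Proof.
rewrite card_tagged sumnE big_map big_enum /=.
by apply: eq_bigr => k _; rewrite card_ord.
Qed.

Lemma card_arow : #|arow D| = (\sum_(k < npass D) ntrial D k * npart D k)%N.
Proof.
rewrite card_tagged sumnE big_map big_enum /=.
rewrite (eq_bigr (fun b : block D => npart D (tag b))); last by move=> b _; rewrite card_ord.
have /= E := @sig_big_dep _ _ addn 'I_(npass D) (fun k => 'I_(ntrial D k))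
  xpredT (fun=> xpredT) (fun k _ => npart D k).
by rewrite -E; apply: eq_bigr => k _; rewrite sum_nat_const card_ord.
Qed.

Lemma M_ge1 : 1 <= M.
Proof. by have := @ln_m_ge0 R m m_ge1; lra. Qed.

Lemma card_block_le : #|block D|%:R <= (c1 + 3) * (l * M ^+ 2).
Proof.
have l0 := ln_ge_third R d_ge2; have M1 := M_ge1.
rewrite card_block natr_sum.
apply: (@le_trans _ _ (\sum_(k < npass D) (c1 + 3) * (l * M))).
  apply: ler_sum => k _; apply: le_trans (ntrial_le k) _.
  rewrite ler_wpM2l ?addr_ge0 ?(ltW c1_gt0) // mulrC ler_wpM2l //; first lra.
  by apply: le_trans (npass_le c1 c2 d m_ge1); rewrite ler_nat.
rewrite sumr_const card_ord -[leLHS]mulr_natr -mulrA ler_wpM2l ?addr_ge0 ?(ltW c1_gt0) //.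
rewrite expr2 mulrA ler_wpM2l ?mulr_ge0 ?npass_le //; lra.
Qed.

Lemma nsketch_le : (nsketch D)%:R <= 108 * (c1 + 3) * (c2 + 1) * m%:R * l ^+ 2.
Proof.
have l0 := ln_ge_third R d_ge2.
have rowE : #|arow D|%:R <= (c1 + 3) * (c2 + 1) * m%:R * l * 12.
  have A0 : 0 <= (c1 + 3) * (c2 + 1) * m%:R * l.
    by rewrite !mulr_ge0 ?addr_ge0 ?(ltW c1_gt0) ?(ltW c2_gt0) //; lra.
  rewrite card_arow natr_sum; apply: le_trans (ler_wpM2l A0 (sum_sqr_geom R (npass D))).
  rewrite mulr_sumr; apply: ler_sum => k _; rewrite natrM.
  have := ler_pM (ler0n _ _) (ler0n _ _) (ntrial_le k) (npart_le (ltn_ord k)).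
  move=> h; apply: le_trans h _.
  have k1 : k.+1%:R <= k.+1%:R ^+ 2 :> R by rewrite expr2 ler_peMl // ler1n.
  have C0 : 0 <= (c1 + 3) * (c2 + 1) * m%:R * l / 2 ^+ k.
    by rewrite !mulr_ge0 ?invr_ge0 ?exprn_ge0 ?addr_ge0 ?(ltW c1_gt0) ?(ltW c2_gt0) //; lra.
  by have := ler_wpM2l C0 k1; congr (_ <= _); ring.
have bE : (nbits D).+1%:R <= 9 * l by rewrite -natr1; have := nbits_le; lra.
rewrite natrM; apply: le_trans (ler_pM (ler0n _ _) (ler0n _ _) rowE bE) _.
lra.
Qed.

(** The bracket belongs to one pass, 12 to the sum over the passes, and 207 * 9 to the work after
    the last pass. *)
Definition time_constant (p : nat) : R :=
  12 * ((c1 + 3) * ((c2 + 1) * (183 + 30 * p%:R) + 12) +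
        (c1 + 3 + 12) * (3 * (c1 + 3) + 6) + 21 * (c1 + 3) + 90 * (c1 + 3) + 108) +
  207 * 9.

Lemma up_log_m_le : (up_log 2 m)%:R <= 3 * M.
Proof. have := up_log_le R m_ge1; lra. Qed.

Lemma pass_cost_le p (k : 'I_(npass D)) :
  (pass_cost D (ntrial D k) (npart D k) (nkeep D k) (p + up_log 2 m)
     (ntrial D k + up_log 2 m)).+1%:R <=
  (time_constant p - 207 * 9) / 12 * (k.+1%:R ^+ 2 / 2 ^+ k * (m%:R * M ^+ 2 * l ^+ 2)).
Proof.
have l0 := ln_ge_third R d_ge2; have M1 := M_ge1.
have k1 : 1 <= k.+1%:R :> R by rewrite ler1n.
set ct := c1 + 3; set cr := c2 + 1.
have ct0 : 0 <= ct by rewrite addr_ge0 ?(ltW c1_gt0).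
have cr0 : 0 <= cr by rewrite addr_ge0 ?(ltW c2_gt0).
set G : R := k.+1%:R * M * l; set y : R := m%:R / 2 ^+ k.
have kl : l <= k.+1%:R * l by nra.
have kM : M <= k.+1%:R * M by nra.
have G1 : M <= 3 * G by rewrite /G; nra.
have lG : l <= G by rewrite /G; nra.
have lMG : k.+1%:R * l <= G by rewrite /G; nra.
have tG : (ntrial D k)%:R <= ct * G.
  by apply: le_trans (ntrial_le k) _; rewrite ler_wpM2l.
have LG : (nbits D)%:R <= 6 * G by have := nbits_le; lra.
have UG : (up_log 2 m)%:R <= 9 * G by have := up_log_m_le; lra.
have bG : #|block D|%:R * (4 * (nbits D)%:R + 7) <= 45 * ct * G ^+ 2.
  have L45 : 4 * (nbits D)%:R + 7 <= 45 * l by have := nbits_le; lra.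
  have := ler_pM (ler0n _ _) _ card_block_le L45.
  rewrite addr_ge0 ?mulr_ge0 // => /(_ isT) h; apply: le_trans h _.
  have -> : (c1 + 3) * (l * M ^+ 2) * (45 * l) = 45 * ct * (M * l) ^+ 2 by rewrite /ct; ring.
  rewrite ler_wpM2l ?mulr_ge0 // lerXn2r ?nnegrE //; last by rewrite /G -mulrA ler_peMl // mulr_ge0; lra.
    by rewrite mulr_ge0; lra.
  by rewrite /G !mulr_ge0; lra.
have y1 : 1 <= y by apply: halving_ge1.
have := @pass_cost_arith R (ntrial D k)%:R (npart D k)%:R (nkeep D k)%:R (nbits D)%:R
  (p%:R + (up_log 2 m)%:R) (up_log 2 m)%:R #|block D|%:R y G ct cr p%:R
  (ler0n _ _) (ler0n _ _) (ler0n _ _) (ler0n _ _) _ (ler0n _ _) (ler0n _ _) ct0 cr0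
  (ler0n _ _) tG (npart_le (ltn_ord k)) (nkeep_le k) LG UG erefl bG y1 _.
rewrite addr_ge0 // => /(_ isT).
have -> : 1 <= 3 * G by lra.
move=> /(_ isT) h.
have -> : (time_constant p - 207 * 9) / 12 * (k.+1%:R ^+ 2 / 2 ^+ k * (m%:R * M ^+ 2 * l ^+ 2)) =
  (ct * (cr * (183 + 30 * p%:R) + 12) + (ct + 12) * (3 * ct + 6) + 21 * ct + 90 * ct + 108) *
    (y * G ^+ 2).
  by rewrite /time_constant /y /G -/ct -/cr; field; rewrite expf_neq0 // pnatr_eq0.
apply: le_trans h.
by rewrite natr_pass_cost !natrD.
Qed.

(** [p] turns the constant in r_k into an additive term of its logarithm: r_k <= 2^p m. *)
Lemma run_time_le p (w : sample D) (V : 'cV[R]_(nsketch D)) : c2 + 1 <= 2 ^+ p ->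
  (run_chaining_pursuit w V).2%:R <= time_constant p * m%:R * M ^+ 2 * l ^+ 2.
Proof.
move=> c2p; have l0 := ln_ge_third R d_ge2; have M1 := M_ge1.
have mU : (m <= 2 ^ up_log 2 m)%N by rewrite up_logP.
have m1 : 1 <= m%:R :> R by rewrite ler1n.
have Bk (Vh : 'cV[R]_(nsketch D) * spikes R D) (k : 'I_(npass D)) : ((run_pass w Vh k).2 <=
    pass_cost D (ntrial D k) (npart D k) (nkeep D k) (p + up_log 2 m) (ntrial D k + up_log 2 m))%N.
  apply: run_pass_time; last exact: ntrial_gt0.
  - have le2k : m%:R / 2 ^+ k <= m%:R :> R.
      by rewrite ler_pdivrMr ?exprn_gt0 // ler_peMr // exprn_ege1 // ler1n.
    have : (npart D k)%:R <= (2 ^ p * m)%:R :> R.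
      rewrite natrM natrX; apply: le_trans (npart_le (ltn_ord k)) _.
      by apply: ler_pM; rewrite ?addr_ge0 ?(ltW c2_gt0) ?divr_ge0 ?exprn_ge0.
    rewrite ler_nat => /leq_trans; apply.
    by rewrite expnD leq_mul2l mU orbT.
  - exact: npart_gt0.
  (* log T_k is bounded crudely by T_k. The sort at the end of a pass then takes time about (T_k +
     log m) T_k m_k, which the square of G still covers. *)
  rewrite expnD leq_mul ?(ltnW (ltn_expl _ _)) //; apply: leq_trans mU.
  rewrite -(ler_nat R); apply: le_trans (nkeep_le k) _.
  by rewrite ler_pdivrMr ?exprn_gt0 // ler_peMr // exprn_ege1 // ler1n.
have nu : (\sum_(k < npass D) 2 * nkeep D k <= 4 * m)%N.
  rewrite -(ler_nat R) natr_sum natrM.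
  apply: (@le_trans _ _ (\sum_(k < npass D) 4 * m%:R * 2 ^- k.+1)).
    apply: ler_sum => k _; rewrite natrM exprS; have := nkeep_le k.
    by rewrite invfM; lra.
  have geo n : \sum_(k < n) 2 ^- k.+1 = 1 - 2 ^- n :> R.
    elim: n => [|n IHn]; first by rewrite big_ord0 expr0 invr1 subrr.
    by rewrite big_ord_recr IHn /= exprS; field; rewrite expf_neq0 //= pnatr_eq0.
  by rewrite -mulr_sumr geo ger_pMr ?gerBl ?invr_ge0 ?exprn_ge0 //; lra.
have uj : (4 * m <= 2 ^ (2 + up_log 2 m))%N by rewrite expnD leq_mul2l mU.
have := run_chaining_pursuit_time V Bk (fun k => ntrial_gt0 c2 m d_ge2 c1_gt0 k) nu uj.
rewrite -(ler_nat R) => h; apply: le_trans h _.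
rewrite 4!natrD natr_sum.
have s1 : \sum_(k < npass D) (pass_cost D (ntrial D k) (npart D k) (nkeep D k)
     (p + up_log 2 m) (ntrial D k + up_log 2 m)).+1%:R <=
   (time_constant p - 207 * 9) * (m%:R * M ^+ 2 * l ^+ 2).
  apply: (@le_trans _ _ (\sum_(k < npass D) (time_constant p - 207 * 9) / 12 *
     (k.+1%:R ^+ 2 / 2 ^+ k * (m%:R * M ^+ 2 * l ^+ 2)))).
    by apply: ler_sum => k _; apply: pass_cost_le.
  rewrite -mulr_sumr -mulr_suml.
  have tc0 : 0 <= (time_constant p - 207 * 9) / 12.
    have ct0 : 0 <= c1 + 3 by rewrite addr_ge0 ?(ltW c1_gt0).
    have cr0 : 0 <= c2 + 1 by rewrite addr_ge0 ?(ltW c2_gt0).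
    have -> : (time_constant p - 207 * 9) / 12 = (c1 + 3) * ((c2 + 1) * (183 + 30 * p%:R) + 12) +
        (c1 + 3 + 12) * (3 * (c1 + 3) + 6) + 21 * (c1 + 3) + 90 * (c1 + 3) + 108.
      by rewrite /time_constant; field.
    have h1 : 0 <= (c1 + 3) * ((c2 + 1) * (183 + 30 * p%:R) + 12).
      by rewrite mulr_ge0 // addr_ge0 // mulr_ge0 // addr_ge0 // mulr_ge0.
    have h2 : 0 <= (c1 + 3 + 12) * (3 * (c1 + 3) + 6).
      by rewrite mulr_ge0 // addr_ge0 // mulr_ge0.
    lra.
  have X0 : 0 <= m%:R * M ^+ 2 * l ^+ 2 by rewrite !mulr_ge0 ?exprn_ge0 //; lra.
  have := ler_wpM2l tc0 (ler_wpM2r X0 (sum_sqr_geom R (npass D))).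
  by move=> h; apply: le_trans h _; 
    rewrite [leLHS](_ : _ =
      (time_constant p - 207 * 9) * (m%:R * M ^+ 2 * l ^+ 2)) //; field.
(* 207 = 168 + 33 + 6, and the factor 9 comes from 1 <= 9 (ln d)^2. *)
have s2 : ((2 + up_log 2 m).+1 * (6 * (4 * m) + 4))%:R + (8 * (4 * m))%:R + m%:R + 6 <=
    207 * 9 * (m%:R * M ^+ 2 * l ^+ 2) :> R.
  have mM : m%:R <= m%:R * M by rewrite ler_peMr.
  have l9 : 1 <= 9 * l ^+ 2 by nra.
  have Ml9 : 1 <= 9 * (M * l ^+ 2) by nra.
  have mM9 : m%:R * M <= 9 * (m%:R * M ^+ 2 * l ^+ 2).
    have : m%:R * M <= m%:R * M * (9 * (M * l ^+ 2)) by rewrite ler_peMr ?mulr_ge0 //; lra.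
    by move=> h; apply: le_trans h _; rewrite le_eqVlt; apply/orP; left; apply/eqP; ring.
  have U3 := up_log_m_le.
  rewrite -[(2 + _).+1%:R]natr1 !(natrD, natrM) in U3 *.
  have : ((up_log 2 m)%:R + 3) * (24 * m%:R + 4) <= 6 * M * (28 * m%:R).
    by apply: ler_pM; rewrite ?addr_ge0 ?mulr_ge0 //; lra.
  lra.
have add_bounds (x a b c e X Y : R) : x <= X -> a + b + c + e <= Y ->
  x + a + b + c + e <= X + Y by lra.
apply: le_trans (add_bounds _ _ _ _ _ _ _ s1 s2) _.
by rewrite le_eqVlt; apply/orP; left; apply/eqP; ring.
Qed.
End Resources.

Theorem theorem2 (R : realType) :
  exists a c1 c2 C Cprob Csize Ctime : R,
  [/\ 1 < a, 0 < c1 & 0 < c2] /\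
  forall d m : nat, (2 <= d)%N -> (1 <= m)%N ->
  let D := chaining_design a c1 c2 d m in
  [/\ uniform_prob R (fun w : sample D =>
        forall f fm fhat : 'cV[R]_d,
          best_approx m f fm ->
          chaining_pursuit (Phi R w) (Phi R w *m f) fhat ->
          [/\ (nnz fhat <= m)%N,
              l1norm (f - fhat) <= C * (1 + ln m%:R) * l1norm (f - fm) &
              fm = f -> fhat = f])
      >= 1 - Cprob / d%:R ^+ 3,
      (nsketch D)%:R <= Csize * m%:R * (ln d%:R) ^+ 2 &
      forall (w : sample D) (f : 'cV[R]_d),
        let run := run_chaining_pursuit w (Phi R w *m f) in
        chaining_pursuit (Phi R w) (Phi R w *m f) (vector_of run.1) /\
        run.2%:R <= Ctime * m%:R * (1 + ln m%:R) ^+ 2 * (ln d%:R) ^+ 2].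
Proof.
pose c1 : R := 4096 * 705; pose c2 : R := 4096 * 700 ^+ 2 * expR 2.
have c1_gt0 : 0 < c1 by rewrite mulr_gt0.
have c2_gt0 : 0 < c2 by rewrite mulr_gt0 ?expR_gt0 // mulr_gt0 ?exprn_gt0.
(* As [c2] is absolute, so is [p], and with it the time constant. *)
have [p c2p] : exists p, c2 + 1 <= 2 ^+ p.
  exists (Num.truncn (c2 + 1)).+1; apply: le_trans (ltW (truncnS_gt _)) _.
  by rewrite -natrX ler_nat; apply/ltnW/ltn_expl.
exists 8, c1, c2, 1307, 1, (108 * (c1 + 3) * (c2 + 1)), (time_constant c1 c2 p).
split; first by split=> //; rewrite ltr1n.
move=> d m d_ge2 m_ge1 D; split.
- apply: uniform_prob_spread => // w w_spread f fm fhat.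
  exact: spread_recovery.
- exact: nsketch_le.
move=> w f run; split; last exact: run_time_le.
by apply: run_chaining_pursuit_correct => k; apply: ntrial_gt0.
Qed.
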